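(* There exists an absolute constant $c_0>0$ such that the following holds. Let $n,k$ be integers with $1\le k<n$, let $K$ be a convex body in $\mathbb{R}^n$ with $0\in K$, and let $L\subseteq K$ be a Borel set in $\mathbb{R}^n$. For any measure $\mu$ on $\mathbb{R}^n$ with a bounded (Borel) measurable non-negative density, $$\mu(K)^{n-k}-\mu(L)^{n-k}\le\left(c_0\sqrt{n-k}\right)^{k(n-k)}|K|^{\frac{k(n-k)}{n}}\,\sup_{F\in{\rm Gr}_{n-k}}\big(\mu(K\cap F)^{n-k}-\mu(L\cap F)^{n-k}\big).$$
   Context: $|\cdot|$ denotes volume (Lebesgue measure), and ${\rm Gr}_{n-k}$ is the Grassmannian of $(n-k)$-dimensional linear subspaces of $\mathbb{R}^n$. A convex body is a compact convex set with non-empty interior. If $\mu$ has density $f$, then $\mu(B)=\int_B f$ for Borel $B\subset\mathbb{R}^n$, and for $F\in{\rm Gr}_{n-k}$ one writes $\mu(B\cap F)=\int_{B\cap F}f$, where the restriction of the function $f$ to $F$ is integrated against Lebesgue measure on $F$. *)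

(* Defs.v *)
From HB Require Import structures.
From mathcomp Require Import all_boot all_order all_algebra.
From mathcomp Require Import all_classical all_reals all_analysis.
From mathcomp Require Import measurable_realfun.

Set Implicit Arguments.
Unset Strict Implicit.
Unset Printing Implicit Defensive.

Import Order.TTheory GRing.Theory Num.Theory.
Import numFieldNormedType.Exports.

Local Open Scope classical_set_scope.
Local Open Scope ring_scope.

Definition borel_mx_display : measure_display.
Proof. exact: default_measure_display. Qed.

(* The topology on matrices is the one of the entrywise sup norm, so for row
   vectors this is the usual Borel sigma-algebra of R^n. *)
Definition borel_mx (R : realType) (m n : nat) : set (set 'M[R]_(m, n)) :=
  <<s @open 'M[R]_(m, n) >>.

Fact borel_mx0 (R : realType) (m n : nat) : @borel_mx R m n set0.
Proof. exact: sigma_algebra0. Qed.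

Fact borel_mxC (R : realType) (m n : nat) (A : set 'M[R]_(m, n)) :
  borel_mx A -> borel_mx (~` A).
Proof. exact: sigma_algebraC. Qed.

Fact borel_mx_bigcup (R : realType) (m n : nat) (F : (set 'M[R]_(m, n))^nat) :
  (forall i, borel_mx (F i)) -> borel_mx (\bigcup_i F i).
Proof. exact: sigma_algebra_bigcup. Qed.

HB.instance Definition _ (R : realType) (m n : nat) :=
  @isMeasurable.Build borel_mx_display 'M[R]_(m, n) (@borel_mx R m n)
    (@borel_mx0 R m n) (@borel_mxC R m n) (@borel_mx_bigcup R m n).

Lemma open_measurable_mx (R : realType) (m n : nat) (U : set 'M[R]_(m, n)) :
  open U -> measurable U.
Proof. by move=> oU; exact: sub_sigma_algebra. Qed.

Lemma continuous_measurable_mx (R : realType) (m n p q : nat)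
    (f : 'M[R]_(m, n) -> 'M[R]_(p, q)) :
  continuous f -> measurable_fun setT f.
Proof.
move=> cf; apply: (@measurability _ _ _ _ _ _ (@open 'M[R]_(p, q))) => //.
move=> _ [U oU <-]; rewrite setTI; apply: open_measurable_mx.
by apply: open_comp => // x _; exact: cf.
Qed.

Lemma measurable_coord (R : realType) (m n : nat) (i : 'I_m) (j : 'I_n) :
  measurable_fun setT (fun M : 'M[R]_(m, n) => M i j).
Proof.
apply: (measurability _ (RGenOpens.measurableE R)).
move=> _ [_ [a [b ->] <-]]; rewrite setTI; apply: open_measurable_mx.
apply: open_comp; last exact: interval_open.
by move=> x _; exact: coord_continuous.
Qed.

Lemma measurable_fun_mxP d (T : measurableType d) (R : realType) (m n : nat)
    (f : T -> 'M[R]_(m, n)) :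
  (forall i j, measurable_fun setT (fun t => f t i j)) ->
  measurable_fun setT f.
Proof.
move=> mf; apply: (@measurability _ _ _ _ _ _ (@open 'M[R]_(m, n))) => //.
move=> _ [U oU <-]; rewrite setTI.
pose c (p : 'M[rat]_(m, n) * nat) : set 'M[R]_(m, n) :=
  ball (map_mx ratr p.1 : 'M[R]_(m, n)) (p.2.+1%:R^-1 : R).
have -> : U = \bigcup_p (if `[< c p `<=` U >] then c p else set0).
  apply/seteqP; split=> [x Ux|x [p _]]; last by case: asboolP => // /[apply].
  have /nbhs_ballP[e /= e0 xeU] : nbhs x U by exact: open_nbhs_nbhs.
  have [k ke] : exists k : nat, k.+1%:R^-1 + k.+1%:R^-1 < e.
    have /ltr_add_invr[k] : 0 < e / 2 by rewrite divr_gt0.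
    rewrite add0r => ke; exists k.
    by rewrite [ltRHS]splitr ltrD.
  have k0 : 0 < k.+1%:R^-1 :> R by rewrite invr_gt0.
  have /(_ _ _)/cid q i j : exists q : rat, ball (ratr q : R) k.+1%:R^-1 (x i j).
    have /rat_in_itvoo[q] : x i j - k.+1%:R^-1 < x i j + k.+1%:R^-1.
      by rewrite ltrBlDr -addrA ltrDl addr_gt0.
    rewrite in_itv/= => /andP[xq qx]; exists q.
    by rewrite /ball/= ltr_distl xq qx.
  pose Q : 'M[rat]_(m, n) := \matrix_(i, j) sval (q i j).
  have cx : c (Q, k) x.
    split => // i j; rewrite !mxE; exact: (svalP (q i j)).
  exists (Q, k) => //.
  rewrite asboolT//; apply: subset_trans xeU => y cy.
  apply: (le_ball (ltW ke)).
  apply: (@ball_triangle _ _ (map_mx ratr Q : 'M[R]_(m, n))) => //.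
  exact: ball_sym.
rewrite preimage_bigcup; apply: countable_bigcupT_measurable => // p.
case: ifPn => _; last by rewrite preimage_set0.
rewrite (_ : _ @^-1` _ =
    \bigcap_(i in [set: 'I_m]) \bigcap_(j in [set: 'I_n]) (setT `&`
      (fun t => f t i j) @^-1` ball (ratr (p.1 i j) : R) (p.2.+1%:R^-1 : R))).
  apply: fin_bigcap_measurable => // i _.
  apply: fin_bigcap_measurable => // j _.
  apply: mf => //; apply: open_measurable; exact: ball_open.
apply/seteqP; split=> [t [_ ft] i _ j _|t ft].
  by split => //; have := ft i j; rewrite mxE.
by split=> // i j; have [_] := ft i I j I; rewrite mxE.
Qed.

Definition rV_cons (R : realType) (n : nat) (p : R * 'rV[R]_n) : 'rV[R]_n.+1 :=
  \row_j oapp (p.2 ord0) p.1 (unlift ord0 j).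

Definition rV_uncons (R : realType) (n : nat) (x : 'rV[R]_n.+1) :
  R * 'rV[R]_n := (x ord0 ord0, \row_j x ord0 (lift ord0 j)).

Lemma rV_cons0 (R : realType) (n : nat) (p : R * 'rV[R]_n) i :
  rV_cons p i ord0 = p.1.
Proof. by rewrite mxE unlift_none. Qed.

Lemma rV_consS (R : realType) (n : nat) (p : R * 'rV[R]_n) i (j : 'I_n) :
  rV_cons p i (lift ord0 j) = p.2 ord0 j.
Proof. by rewrite mxE liftK. Qed.

Lemma rV_consK (R : realType) (n : nat) :
  cancel (@rV_cons R n) (@rV_uncons R n).
Proof.
move=> [a y]; rewrite /rV_uncons rV_cons0; congr pair.
by apply/rowP => j; rewrite mxE rV_consS.
Qed.

Lemma measurable_rV_cons (R : realType) (n : nat) :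
  measurable_fun setT (@rV_cons R n).
Proof.
apply: measurable_fun_mxP => i j; case: (unliftP ord0 j) => [k|] ->.
  rewrite (_ : (fun _ => _) = (fun y : 'rV[R]_n => y ord0 k) \o snd).
    by apply: measurableT_comp => //; exact: measurable_coord.
  by apply/funext => p; rewrite rV_consS.
by rewrite (_ : (fun _ => _) = fst) //; apply/funext => p; rewrite rV_cons0.
Qed.

Lemma measurable_rV_uncons (R : realType) (n : nat) :
  measurable_fun setT (@rV_uncons R n).
Proof.
apply/measurable_fun_pairP; split; first exact: measurable_coord.
apply: measurable_fun_mxP => i j.
rewrite (_ : (fun _ => _) = (fun x : 'rV[R]_n.+1 => x ord0 (lift ord0 j))).
  exact: measurable_coord.
by apply/funext => x; rewrite /= mxE.
Qed.

Definition rV_cons_measure (R : realType) (n : nat)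
    (mu : {sigma_finite_measure set 'rV[R]_n -> \bar R}) :
    set 'rV[R]_n.+1 -> \bar R :=
  pushforward (@lebesgue_measure R \x mu)%E (@rV_cons R n).

Section rV_cons_measure.
Local Open Scope ereal_scope.
Context (R : realType) (n : nat)
  (mu : {sigma_finite_measure set 'rV[R]_n -> \bar R}).

Let mcons : measurable_fun setT (@rV_cons R n) := @measurable_rV_cons R n.

Let nu0 : rV_cons_measure mu set0 = 0. Proof. exact: measure0. Qed.

Let nu_ge0 A : 0 <= rV_cons_measure mu A. Proof. exact: measure_ge0. Qed.

Let nu_sigma_additive : semi_sigma_additive (rV_cons_measure mu).
Proof. exact: measure_semi_sigma_additive. Qed.

HB.instance Definition _ := isMeasure.Build _ _ _ (rV_cons_measure mu)
  nu0 nu_ge0 nu_sigma_additive.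

Let nu_sigma_finite : sigma_finite setT (rV_cons_measure mu).
Proof.
have /sigma_finiteP[F [TF ndF Foo]] := sigma_finiteT (@lebesgue_measure R).
have /sigma_finiteP[G [TG ndG Goo]] := sigma_finiteT mu.
exists (fun i => @rV_uncons R n @^-1` (F i `*` G i)).
  apply/seteqP; split=> // x _.
  have [i _ Fix] : (\bigcup_i F i) (rV_uncons x).1 by rewrite -TF.
  have [j _ Gjx] : (\bigcup_i G i) (rV_uncons x).2 by rewrite -TG.
  exists (maxn i j) => //; split.
    by move: Fix; exact/subsetPset/ndF/leq_maxl.
  by move: Gjx; exact/subsetPset/ndG/leq_maxr.
move=> i; have [mF Fi] := Foo i; have [mG Gi] := Goo i; split.
  rewrite -[X in measurable X]setTI; apply: measurable_rV_uncons => //.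
  exact: measurableX.
rewrite /rV_cons_measure /pushforward (_ : _ @^-1` _ = F i `*` G i).
  by rewrite product_measure1E// lte_mul_pinfty// ge0_fin_numE.
rewrite -comp_preimage (_ : _ \o _ = id) ?preimage_id//.
by apply/funext => p; exact: rV_consK.
Qed.

HB.instance Definition _ := Measure_isSigmaFinite.Build _ _ _
  (rV_cons_measure mu) nu_sigma_finite.

End rV_cons_measure.

(* n-fold product of the Lebesgue measure of R; see lebesgue_rV_box *)
Fixpoint lebesgue_rV (R : realType) (n : nat) :
    {sigma_finite_measure set 'rV[R]_n -> \bar R} :=
  match n with
  | 0 => \d_(0 : 'rV[R]_0)
  | m.+1 => rV_cons_measure (lebesgue_rV R m)
  end.

Lemma lebesgue_rV_box (R : realType) (n : nat) (A : 'I_n -> set R) :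
  (forall i, measurable (A i)) ->
  lebesgue_rV R n [set x | forall i, A i (x ord0 i)] =
  (\prod_(i < n) @lebesgue_measure R (A i))%E.
Proof.
elim: n A => [|n IHn] A mA.
  by rewrite big_ord0 /= diracE mem_set//= => -[].
rewrite big_ord_recl -IHn; last by move=> i; exact: mA.
have mB : measurable
    [set x : 'rV[R]_n | forall i : 'I_n, A (lift ord0 i) (x ord0 i)].
  rewrite (_ : mkset _ = \bigcap_(i in [set: 'I_n])
     (setT `&` (fun x : 'rV[R]_n => x ord0 i) @^-1` A (lift ord0 i))).
    by apply: fin_bigcap_measurable => // i _; exact: measurable_coord.
  apply/seteqP; split=> x /= Ax i; first by move=> _; split.
  by have [] := Ax i I.
rewrite -(product_measure1E (@lebesgue_measure R) (lebesgue_rV R n) (mA ord0) mB).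
rewrite /rV_cons_measure /pushforward; congr (product_measure1 _ _ _).
apply/seteqP; split=> -[a y] /=.
  move=> Aay; split; first by have := Aay ord0; rewrite rV_cons0.
  by move=> i; have := Aay (lift ord0 i); rewrite rV_consS.
move=> [Aa Ay] i; case: (unliftP ord0 i) => [k|] ->.
  by rewrite rV_consS; exact: Ay.
by rewrite rV_cons0.
Qed.

Definition orthonormal_basis_of (R : realType) (n : nat)
    (F : {vspace 'rV[R]_n}) (B : 'M[R]_(\dim F, n)) : Prop :=
  B *m B^T = 1%:M /\ basis_of F [tuple row i B | i < \dim F].

Lemma orthonormal_basis_ex (R : realType) (n : nat) (F : {vspace 'rV[R]_n}) :
  exists B, @orthonormal_basis_of R n F B.
Proof.
have key d : (d <= \dim F)%N -> exists B : 'M[R]_(d, n),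
    B *m B^T = 1%:M /\ forall i, row i B \in F.
  elim: d => [_|d IHd dF].
    by exists 0; split; [rewrite [LHS]flatmx0 [RHS]flatmx0|case].
  have [B [BB BF]] := IHd (ltnW dF).
  have [u uF uB] : exists2 u, u \in F & u \notin
      <<[tuple row i B | i < d]>>%VS.
    apply/not_exists2P => FB.
    have /dimvS : (F <= <<[tuple row i B | i < d]>>)%VS.
      apply/subvP => u uF; apply/negPn/negP => uB.
      by case: (FB u).
    rewrite leqNgt (leq_ltn_trans (dim_span _))//.
    by rewrite size_tuple.
  have mulB (w : 'rV[R]_d) : w *m B \in
      <<[tuple row i B | i < d]>>%VS.
    rewrite mulmx_sum_row; apply: memv_suml => i _; apply: memvZ.
    apply: memv_span.
    by have := mem_tnth i [tuple row i B | i < d]; rewrite tnth_mktuple.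
  have BsubF (w : 'rV[R]_d) : w *m B \in F.
    by rewrite mulmx_sum_row; apply: memv_suml => i _; exact: memvZ.
  pose v := u - u *m B^T *m B.
  have v0 : v != 0.
    by apply: contra uB; rewrite subr_eq0 => /eqP ->; exact: mulB.
  have vF : v \in F by rewrite memvB.
  have vB : v *m B^T = 0 by rewrite mulmxBl -!mulmxA BB mulmx1 subrr.
  clearbody v.
  pose q := (v *m v^T) ord0 ord0.
  have qE : q = \sum_i v ord0 i ^+ 2.
    by rewrite /q mxE; apply: eq_bigr => i _; rewrite mxE expr2.
  have q0 : 0 < q.
    rewrite lt_neqAle qE sumr_ge0 ?andbT => [|i _]; last exact: sqr_ge0.
    apply: contra v0 => /eqP/esym/eqP.
    rewrite psumr_eq0 => [/allP v0|i _]; last exact: sqr_ge0.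
    apply/eqP/rowP => i; rewrite mxE; apply/eqP; rewrite -sqrf_eq0.
    exact: v0 (mem_index_enum i).
  pose w := (Num.sqrt q)^-1 *: v.
  have ww : w *m w^T = 1%:M.
    rewrite /w linearZ /= -scalemxAl -scalemxAr scalerA.
    rewrite [v *m v^T]mx11_scalar -/q scale_scalar_mx.
    by rewrite -invfM -expr2 sqr_sqrtr ?ltW// mulVf// gt_eqF.
  have wB : w *m B^T = 0 by rewrite -scalemxAl vB scaler0.
  have Bw : B *m w^T = 0 by rewrite -[LHS]trmxK trmx_mul trmxK wB trmx0.
  have CC : col_mx w B *m (col_mx w B)^T = 1%:M.
    by rewrite tr_col_mx mul_col_row ww wB Bw BB -scalar_mx_block.
  have CF (i : 'I_(1 + d)) : row i (col_mx w B) \in F.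
    case: (split_ordP i) => k ->; last by rewrite rowKd.
    rewrite rowKu (_ : row k w = w) ?memvZ//.
    by apply/rowP => j; rewrite mxE ord1.
  by exists (col_mx w B); split; [exact: CC|exact: CF].
have [B [BB BF]] := key _ (leqnn _).
exists B; split => //.
rewrite basisEfree size_tuple leqnn andbT; apply/andP; split; last first.
  by apply/span_subvP => _ /tnthP[i ->]; rewrite tnth_mktuple.
apply/freeP => c cB i.
have : (\row_j c j) *m B = 0.
  rewrite mulmx_sum_row -[RHS]cB; apply: eq_bigr => j _.
  by rewrite mxE -tnth_nth tnth_mktuple.
move=> /(congr1 (mulmx^~ B^T)); rewrite -mulmxA BB mulmx1 mul0mx.
by move=> /rowP/(_ i); rewrite !mxE.
Qed.

Definition orthonormal_basis (R : realType) (n : nat) (F : {vspace 'rV[R]_n}) :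
    'M[R]_(\dim F, n) :=
  xget 0 [set B | orthonormal_basis_of B].

Lemma orthonormal_basisP (R : realType) (n : nat) (F : {vspace 'rV[R]_n}) :
  orthonormal_basis_of (orthonormal_basis F).
Proof. exact: (xgetPex 0 (orthonormal_basis_ex F)). Qed.

(* Lebesgue measure on F for the standard inner product, as a measure on the
   ambient space carried by F: the image of Lebesgue measure under the linear
   isometry y |-> y *m B, where the rows of B are an orthonormal basis of F. By
   invariance of Lebesgue measure under orthogonal maps, the choice of B is
   irrelevant. *)
Definition lebesgue_on (R : realType) (n : nat) (F : {vspace 'rV[R]_n}) :
    set 'rV[R]_n -> \bar R :=
  pushforward (lebesgue_rV R (\dim F)) (mulmxr (orthonormal_basis F)).

Lemma measurable_mulmxr (R : realType) (m n p : nat) (B : 'M[R]_(n, p)) :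
  measurable_fun setT (mulmxr B : 'M[R]_(m, n) -> 'M[R]_(m, p)).
Proof.
apply: measurable_fun_mxP => i j.
rewrite (_ : (fun _ => _) = fun A : 'M[R]_(m, n) => \sum_k A i k * B k j).
  apply: measurable_sum => k; apply: measurable_funM => //.
  exact: measurable_coord.
by apply/funext => A; rewrite /= mxE.
Qed.

Section lebesgue_on.
Local Open Scope ereal_scope.
Context (R : realType) (n : nat) (F : {vspace 'rV[R]_n}).

Let mB : measurable_fun setT
    (mulmxr (orthonormal_basis F) : 'rV[R]_(\dim F) -> 'rV[R]_n) :=
  @measurable_mulmxr R 1 _ _ (orthonormal_basis F).

Let lebesgue_on0 : lebesgue_on F set0 = 0. Proof. exact: measure0. Qed.

Let lebesgue_on_ge0 A : 0 <= lebesgue_on F A. Proof. exact: measure_ge0. Qed.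

Let lebesgue_on_sigma_additive : semi_sigma_additive (lebesgue_on F).
Proof. exact: measure_semi_sigma_additive. Qed.

HB.instance Definition _ := isMeasure.Build _ _ _ (lebesgue_on F)
  lebesgue_on0 lebesgue_on_ge0 lebesgue_on_sigma_additive.

End lebesgue_on.

Definition has_density (R : realType) (n : nat)
    (mu : set 'rV[R]_n -> \bar R) (f : 'rV[R]_n -> R) : Prop :=
  forall A : set 'rV[R]_n, measurable A ->
    mu A = (\int[lebesgue_rV R n]_(x in A) (f x)%:E)%E.

(* mu(A `&` F), where mu has density f: f is integrated over A `&` F against
   the Lebesgue measure of F *)
Definition section_measure (R : realType) (n : nat) (f : 'rV[R]_n -> R)
    (F : {vspace 'rV[R]_n}) (A : set 'rV[R]_n) : \bar R :=
  (\int[lebesgue_on F]_(x in A `&` [set` F]) (f x)%:E)%E.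

Definition Grassmannian (R : realType) (n m : nat) :
    set {vspace 'rV[R]_n} :=
  [set F | \dim F = m].

Definition convex_body (R : realType) (n : nat) (K : set 'rV[R]_n) : Prop :=
  [/\ compact K, convex_set K & K° !=set0].

(* Main.v *)
Require Import Defs.
From HB Require Import structures.
From mathcomp Require Import all_boot all_order all_algebra all_fingroup.
From mathcomp Require Import all_classical all_reals all_analysis.
From mathcomp Require Import measurable_realfun ring lra zify.

Set Implicit Arguments.
Unset Strict Implicit.
Unset Printing Implicit Defensive.

Import Order.TTheory GRing.Theory Num.Theory.
Import numFieldNormedType.Exports.

Local Open Scope classical_set_scope.
Local Open Scope ring_scope.

(** Write [n = m + k]. Almost every [m]-tuple of points of [R^n] spans the graph
    of a linear map from [R^m] to [R^k], so it can be written as the rows of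
    [(Y | Y A)], where [A] describes the subspace and the rows of [Y] are
    coordinates in it. In these variables Lebesgue measure on tuples is
    [|det Y|^k dY dA] ([blaschke_petkantschin]). The difference
    [mu(K)^m - mu(L)^m] is the integral of [f(x_1) ... f(x_m)] over the tuples of
    points of [K] that do not all lie in [L]. If the factor [|det Y|^k] were
    absent, the fibre over [A] would contribute [t(A)^m] times the difference for
    the sections by the graph of [A], where [t(A)] is the volume contraction
    [graph_factor] of the projection of that graph onto [R^m]
    ([section_sub_integral]). So it suffices to bound [|det Y|^k t(A)^m], for [Y]
    with rows in the fibre [K_A] of [K], by a function of [A] alone whose integral
    has the size required.

    That bound is a weighted mean of two densities ([det_fiber_weight]). First,
    [K_A] is convex and contains the origin, so together with the rows of [Y] it
    contains a whole simplex; hence [|det Y|^(m+k)] is at most a constant times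
    the integral [I(A)] of [|det|^k] over the tuples of [K_A]
    ([simplex_det_moment]). The parametrization applied to the tuples of [K] says
    that [I] has integral [|K|^m]. Second, the parametrization applied to a
    Gaussian says that [t(A)^(m+k)] has integral [1 / E|det G|^k] for a Gaussian
    matrix [G] ([integral_graph_factor]). The AM-GM inequality with weights
    [k/n] and [m/n] multiplies the two ([det_AGM]).

    The constant is of order [sqrt m] to the power [k m] because both moments of
    the determinant are as large as they are for typical random matrices. For the
    simplex it is enough to look at a cube inside it, and random signs give
    determinants with square at least [m!] ([det_signs]). For the Gaussian,
    convexity reduces to [k = 1], where [E|det G|] is the inverse of the integral
    of [(1 + |a|^2)^(-(m+1)/2)] over [R^m], estimated on dyadic shells
    ([gauss_det_moment1_ge]). *)

(** * Lebesgue measure on matrices *)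

Definition mx_box (R : realType) (m n : nat) (A : 'I_m -> 'I_n -> set R) :
  set 'M[R]_(m, n) := [set X | forall i j, A i j (X i j)].

Lemma measurable_mx_box (R : realType) (m n : nat) (A : 'I_m -> 'I_n -> set R) :
  (forall i j, measurable (A i j)) -> measurable (mx_box A).
Proof.
move=> mA; rewrite (_ : mx_box A = \bigcap_(i in [set: 'I_m])
    \bigcap_(j in [set: 'I_n]) (setT `&`
      (fun X : 'M[R]_(m, n) => X i j) @^-1` A i j)).
  apply: fin_bigcap_measurable => // i _.
  apply: fin_bigcap_measurable => // j _.
  exact: measurable_coord.
apply/seteqP; split=> [X AX i _ j _|X AX i j]; first by split.
by have [] := AX i I j I.
Qed.

(** Coordinatewise measurability characterizes measurable matrix-valued maps;
    it is applied to the identity from the sigma-algebra generated by boxes. *)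
Lemma measurable_mxE (R : realType) (m n : nat) :
  @measurable _ 'M[R]_(m, n) =
  <<s [set mx_box A | A in [set A : 'I_m -> 'I_n -> set R |
                            forall i j, measurable (A i j)]] >>.
Proof.
set G := (X in <<s X >>).
apply/seteqP; split=> [B mB|]; last first.
  apply: smallest_sub; first exact: sigma_algebra_measurable.
  by move=> _ [A mA <-]; exact: measurable_mx_box.
have mid : measurable_fun [set: g_sigma_algebraType G]
    (id : g_sigma_algebraType G -> 'M[R]_(m, n)).
  apply: measurable_fun_mxP => i j _ C mC; rewrite setTI.
  apply: sub_sigma_algebra.
  exists (fun i' j' => if (i' == i) && (j' == j) then C else setT).
    by move=> i' j'; case: ifP.
  apply/seteqP; split=> X /=; first by move=> /(_ i j); rewrite !eqxx.
  by move=> CX i' j'; case: ifP => // /andP[/eqP-> /eqP->].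
by have := mid measurableT B mB; rewrite setTI.
Qed.

Lemma measurable_vec_mx (R : realType) (m n : nat) :
  measurable_fun setT (@vec_mx R m n).
Proof.
apply: measurable_fun_mxP => i j.
rewrite (_ : (fun _ => _) = fun v : 'rV[R]_(m * n) => v ord0 (mxvec_index i j)).
  exact: measurable_coord.
by apply/funext => v; rewrite mxE.
Qed.

(** The product of one copy of Lebesgue measure for each entry; the flattening
    to row vectors is invisible on boxes, see [lebesgue_mx_box]. *)
Definition lebesgue_mx (R : realType) (m n : nat) : set 'M[R]_(m, n) -> \bar R :=
  pushforward (lebesgue_rV R (m * n)) (@vec_mx R m n).

Section lebesgue_mx_measure.
Local Open Scope ereal_scope.
Context (R : realType) (m n : nat).

Let mv : measurable_fun setT (@vec_mx R m n) := @measurable_vec_mx R m n.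

Let lebesgue_mx0 : @lebesgue_mx R m n set0 = 0. Proof. exact: measure0. Qed.

Let lebesgue_mx_ge0 A : 0 <= @lebesgue_mx R m n A.
Proof. exact: measure_ge0. Qed.

Let lebesgue_mx_sigma_additive : semi_sigma_additive (@lebesgue_mx R m n).
Proof. exact: measure_semi_sigma_additive. Qed.

HB.instance Definition _ := isMeasure.Build _ _ _ (@lebesgue_mx R m n)
  lebesgue_mx0 lebesgue_mx_ge0 lebesgue_mx_sigma_additive.

Lemma lebesgue_mx_box (A : 'I_m -> 'I_n -> set R) :
  (forall i j, measurable (A i j)) ->
  @lebesgue_mx R m n (mx_box A) =
  \prod_(i < m) \prod_(j < n) @lebesgue_measure R (A i j).
Proof.
move=> mA; rewrite /lebesgue_mx /pushforward.
pose c (k : 'I_(m * n)) := enum_val (cast_ord (esym (mxvec_cast m n)) k).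
have ck i j : c (mxvec_index i j) = (i, j).
  by rewrite /c /mxvec_index cast_ordK enum_rankK.
have -> : @vec_mx R m n @^-1` mx_box A =
    [set x : 'rV[R]_(m * n) | forall k, A (c k).1 (c k).2 (x ord0 k)].
  apply/seteqP; split=> x /= Ax.
    move=> k; case/mxvec_indexP: k => i j; rewrite ck.
    by have := Ax i j; rewrite mxE.
  by move=> i j; rewrite mxE; have := Ax (mxvec_index i j); rewrite ck.
rewrite (@lebesgue_rV_box R (m * n) (fun k => A (c k).1 (c k).2))//.
rewrite pair_bigA /= (reindex (uncurry (@mxvec_index m n))).
  by apply: eq_bigr => -[i j] _; rewrite /= ck.
exact: curry_mxvec_bij.
Qed.

Let cube (k : nat) : set 'M[R]_(m, n) :=
  mx_box (fun _ _ => `[(- k%:R)%R, k%:R%R]%classic).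

Let cube_cover : \bigcup_k cube k = setT.
Proof.
apply/seteqP; split=> // X _.
exists (Num.truncn (\sum_i \sum_j `|X i j|)%R).+1 => // i j.
rewrite /= in_itv /= -ler_norml.
apply/ltW/(le_lt_trans _ (truncnS_gt _)).
rewrite (bigD1 i)//= (bigD1 j)//= -addrA lerDl addr_ge0// ?sumr_ge0// => *.
by rewrite sumr_ge0.
Qed.

Let cube_fin k : @lebesgue_mx R m n (cube k) < +oo.
Proof.
rewrite lebesgue_mx_box//.
rewrite ltey_eq; apply/orP; left.
apply: prode_fin_num => i _; apply: prode_fin_num => j _.
rewrite lebesgue_measure_itv/=; by case: ifP.
Qed.

Let lebesgue_mx_sigma_finite : sigma_finite setT (@lebesgue_mx R m n).
Proof.
exists cube; first by rewrite cube_cover.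
by move=> k; split; [exact: measurable_mx_box|exact: cube_fin].
Qed.

HB.instance Definition _ := Measure_isSigmaFinite.Build _ _ _
  (@lebesgue_mx R m n) lebesgue_mx_sigma_finite.

(** Boxes form a generating pi-system, so every rearrangement of coordinates
    below is recognized by its action on boxes. *)
Lemma lebesgue_mx_unique (nu : {measure set 'M[R]_(m, n) -> \bar R}) :
  (forall A : 'I_m -> 'I_n -> set R, (forall i j, measurable (A i j)) ->
    nu (mx_box A) = \prod_(i < m) \prod_(j < n) @lebesgue_measure R (A i j)) ->
  forall B, measurable B -> @lebesgue_mx R m n B = nu B.
Proof.
move=> nuE; apply: (measure_unique _ cube (@measurable_mxE R m n)) => //.
- move=> _ _ [A mA <-] [B mB <-]; exists (fun i j => A i j `&` B i j).
    by move=> i j; exact: measurableI.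
  apply/seteqP; split=> X /=; last by move=> [? ?] i j; split.
  by move=> AB; split=> i j; have [] := AB i j.
- by move=> k; eexists; last reflexivity.
- move=> _ [A mA <-]; apply: etrans (esym (nuE _ mA)); exact: lebesgue_mx_box.
Qed.

End lebesgue_mx_measure.

(** * Affine maps of the line *)

(** Carries the measurability proof along, so that a pushforward can be passed
    where a bundled measure is expected. *)
Definition image_measure d d' (T1 : measurableType d) (T2 : measurableType d')
    (R : realType) (m : {measure set T1 -> \bar R}) (f : T1 -> T2)
    (mf : measurable_fun [set: T1] f) : {measure set T2 -> \bar R}.
Proof.
by refine (pushforward m f : {measure set T2 -> \bar R}); exact: mf.
Defined.

Section lebesgue_measure_affine.
Local Open Scope ereal_scope.
Context (R : realType).
Local Notation lambda := (@lebesgue_measure R).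

Lemma measurable_affine (a u : R) :
  measurable_fun setT ((fun x => a + u * x)%R : R -> measurableTypeR R).
Proof. by apply: measurable_funD => //; exact: measurable_funM. Qed.

Lemma lebesgue_measure_affine_gt0 (a u : R) (A : set R) : (0 < u)%R ->
  measurable A -> u%:E * lambda ((fun x => a + u * x)%R @^-1` A) = lambda A.
Proof.
move=> u0 mA.
pose mf := measurable_affine a u.
pose nu : {measure set (measurableTypeR R) -> \bar R} :=
  mscale (NngNum (ltW u0)) (image_measure lambda mf).
have /(_ _ mA) : forall B, measurable B -> lambda B = nu B; last first.
  by move=> ->.
move=> B mB; apply: lebesgue_measure_unique => //= _ [[b c]] _ <-.
rewrite /nu /= /mscale /= /pushforward.
have -> : (fun x => a + u * x)%R @^-1` `]b, c] =
    `]((b - a) / u)%R, ((c - a) / u)%R]%classic.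
  apply/seteqP; split=> x /=; rewrite !in_itv /=.
    by rewrite ltr_pdivrMr// ler_pdivlMr// ltrBlDl lerBrDl mulrC.
  by rewrite ltr_pdivrMr// ler_pdivlMr// ltrBlDl lerBrDl mulrC.
rewrite !lebesgue_measure_itv/= !lte_fin ltr_pM2r ?invr_gt0// ltrD2r.
case: ifP => _; last by rewrite mule0.
rewrite -!EFinD -EFinM; congr EFin.
rewrite -mulrBl mulrC divfK ?gt_eqF//.
by rewrite opprB addrA subrK.
Qed.

Lemma lebesgue_measure_affine (a u : R) (A : set R) : u != 0%R ->
  measurable A ->
  `|u|%:E * lambda ((fun x => a + u * x)%R @^-1` A) = lambda A.
Proof.
rewrite neq_lt => /orP[u0|u0] mA; last first.
  by rewrite gtr0_norm// lebesgue_measure_affine_gt0.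
rewrite ltr0_norm// -[RHS](@lebesgue_measure_affine_gt0 a (- u)) ?oppr_gt0//.
congr (_ * _); rewrite -[RHS]lebesgue_measureN.
  by congr lambda; apply/seteqP; split=> x /=; rewrite mulrNN.
by rewrite -[X in measurable X]setTI; apply: measurable_affine.
Qed.

End lebesgue_measure_affine.

(** * Block decompositions of the integral *)

Lemma lebesgue_mx_transfer (R : realType) (m n : nat) d (T : measurableType d)
    (mu : {measure set T -> \bar R}) (phi : T -> 'M[R]_(m, n)) :
  measurable_fun setT phi ->
  (forall A : 'I_m -> 'I_n -> set R, (forall i j, measurable (A i j)) ->
    mu (phi @^-1` mx_box A) =
    \prod_(i < m) \prod_(j < n) @lebesgue_measure R (A i j))%E ->
  forall g : 'M[R]_(m, n) -> \bar R, measurable_fun setT g ->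
  (forall X, 0 <= g X)%E ->
  (\int[@lebesgue_mx R m n]_X g X = \int[mu]_t g (phi t))%E.
Proof.
move=> mphi muE g mg g0.
rewrite (eq_measure_integral (image_measure mu mphi)).
  by rewrite ge0_integral_pushforward.
by move=> A mA _; apply: lebesgue_mx_unique => //=; exact: muE.
Qed.

Section mx_measurability.
Context (R : realType) d (T : measurableType d).

Lemma measurable_fun_trmx (m n : nat) (f : T -> 'M[R]_(m, n)) :
  measurable_fun setT f -> measurable_fun setT (fun t => (f t)^T).
Proof.
move=> mf; apply: measurable_fun_mxP => i j.
rewrite (_ : (fun _ => _) = (fun X : 'M[R]_(m, n) => X j i) \o f).
  by apply: measurableT_comp => //; exact: measurable_coord.
by apply/funext => t; rewrite mxE.
Qed.

Lemma measurable_fun_coord (m n : nat) (f : T -> 'M[R]_(m, n)) i j :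
  measurable_fun setT f -> measurable_fun setT (fun t => f t i j).
Proof. exact: (measurableT_comp (@measurable_coord R m n i j)). Qed.

Lemma measurable_fun_addmx (m n : nat) (f g : T -> 'M[R]_(m, n)) :
  measurable_fun setT f -> measurable_fun setT g ->
  measurable_fun setT (fun t => f t + g t).
Proof.
move=> mf mg; apply: measurable_fun_mxP => i j.
under eq_fun do rewrite mxE.
by apply: measurable_funD; exact: measurable_fun_coord.
Qed.

Lemma measurable_fun_mulmx (m n p : nat) (f : T -> 'M[R]_(m, n))
    (g : T -> 'M[R]_(n, p)) :
  measurable_fun setT f -> measurable_fun setT g ->
  measurable_fun setT (fun t => f t *m g t).
Proof.
move=> mf mg; apply: measurable_fun_mxP => i j.
under eq_fun do rewrite mxE.
apply: measurable_sum => k.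
by apply: measurable_funM; exact: measurable_fun_coord.
Qed.

Lemma measurable_fun_row_mx (m n1 n2 : nat) (f : T -> 'M[R]_(m, n1))
    (g : T -> 'M[R]_(m, n2)) :
  measurable_fun setT f -> measurable_fun setT g ->
  measurable_fun setT (fun t => row_mx (f t) (g t)).
Proof.
move=> mf mg; apply: measurable_fun_mxP => i j; case: (split_ordP j) => k ->.
  by under eq_fun do rewrite row_mxEl; exact: measurable_fun_coord.
by under eq_fun do rewrite row_mxEr; exact: measurable_fun_coord.
Qed.

Lemma measurable_fun_col_mx (m1 m2 n : nat) (f : T -> 'M[R]_(m1, n))
    (g : T -> 'M[R]_(m2, n)) :
  measurable_fun setT f -> measurable_fun setT g ->
  measurable_fun setT (fun t => col_mx (f t) (g t)).
Proof.
move=> mf mg; apply: measurable_fun_mxP => i j; case: (split_ordP i) => k ->.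
  by under eq_fun do rewrite col_mxEu; exact: measurable_fun_coord.
by under eq_fun do rewrite col_mxEd; exact: measurable_fun_coord.
Qed.

Lemma measurable_fun_row (m n : nat) (f : T -> 'M[R]_(m, n)) i :
  measurable_fun setT f -> measurable_fun setT (fun t => row i (f t)).
Proof.
move=> mf; apply: measurable_fun_mxP => i' j.
by under eq_fun do rewrite mxE; exact: measurable_fun_coord.
Qed.

Lemma measurable_fun_det (n : nat) (f : T -> 'M[R]_n) :
  measurable_fun setT f -> measurable_fun setT (fun t => \det (f t)).
Proof.
move=> mf; rewrite /determinant; apply: measurable_sum => s.
apply: measurable_funM => //; apply: measurable_prod => i _.
exact: measurable_fun_coord.
Qed.

End mx_measurability.

Section lebesgue_mx_integrals.
Local Open Scope ereal_scope.
Context (R : realType).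
Local Notation leb m n := (@lebesgue_mx R m n).
Local Notation lambda := (@lebesgue_measure R).

Lemma integral_trmx (m n : nat) (g : 'M[R]_(m, n) -> \bar R) :
  measurable_fun setT g -> (forall X, 0 <= g X) ->
  \int[leb m n]_X g X = \int[leb n m]_X g X^T.
Proof.
apply: lebesgue_mx_transfer; first exact: measurable_fun_trmx.
move=> A mA; rewrite exchange_big/= -lebesgue_mx_box//; congr lebesgue_mx.
by apply/seteqP; split=> X /= AX i j; have := AX j i; rewrite mxE.
Qed.

Lemma integral_addmx (m n : nat) (M : 'M[R]_(m, n))
    (g : 'M[R]_(m, n) -> \bar R) :
  measurable_fun setT g -> (forall X, 0 <= g X) ->
  \int[leb m n]_X g X = \int[leb m n]_X g (M + X)%R.
Proof.
apply: lebesgue_mx_transfer; first exact: measurable_fun_addmx.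
move=> A mA.
transitivity (leb m n
    (mx_box (fun i j => (fun x => M i j + 1 * x)%R @^-1` A i j))).
  congr lebesgue_mx.
  by apply/seteqP; split=> X /= AX i j; have := AX i j; rewrite /= !mxE mul1r.
rewrite lebesgue_mx_box.
  apply: eq_bigr => i _; apply: eq_bigr => j _.
  rewrite -[RHS](@lebesgue_measure_affine R (M i j) 1 _ (oner_neq0 _) (mA i j)).
  by rewrite normr1 mul1e.
move=> i j; have := measurable_affine (M i j) 1 measurableT (mA i j).
by rewrite setTI.
Qed.

Lemma integral_col_perm (m n : nat) (s : 'S_n) (g : 'M[R]_(m, n) -> \bar R) :
  measurable_fun setT g -> (forall X, 0 <= g X) ->
  \int[leb m n]_X g X = \int[leb m n]_X g (col_perm s X).
Proof.
apply: lebesgue_mx_transfer.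
  apply: measurable_fun_mxP => i j; under eq_fun do rewrite mxE.
  exact: measurable_coord.
move=> A mA.
transitivity (leb m n (mx_box (fun i j => A i (s^-1%g j)))).
  congr lebesgue_mx; apply/seteqP; split=> X /= AX i j.
    by have := AX i (s^-1%g j); rewrite mxE permKV.
  by have := AX i (s j); rewrite mxE permK.
rewrite lebesgue_mx_box//; apply: eq_bigr => i _.
rewrite (reindex_inj (@perm_inj _ s)); apply: eq_bigr => j _.
by rewrite permK.
Qed.

Lemma integral_lebesgue_rV (n : nat) (g : 'rV[R]_n -> \bar R) :
  measurable_fun setT g -> (forall X, 0 <= g X) ->
  \int[leb 1 n]_X g X = \int[lebesgue_rV R n]_x g x.
Proof.
apply: lebesgue_mx_transfer; first exact: measurable_id.
move=> A mA; rewrite big_ord1 -lebesgue_rV_box//.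
suff -> : id @^-1` mx_box A =
    [set x : 'rV[R]_n | forall j, A ord0 j (x ord0 j)] by [].
apply/seteqP; split=> x /=; first by move=> Ax j; exact: Ax.
by move=> Ax i j; rewrite ord1.
Qed.

Lemma integral_const_mx (g : 'M[R]_1 -> \bar R) :
  measurable_fun setT g -> (forall X, 0 <= g X) ->
  \int[leb 1 1]_X g X = \int[lambda]_x g (const_mx x).
Proof.
apply: lebesgue_mx_transfer.
  apply: measurable_fun_mxP => i j; under eq_fun do rewrite mxE.
  exact: measurable_id.
move=> A mA; rewrite !big_ord1; congr lambda.
apply/seteqP; split=> x /=; first by move=> /(_ ord0 ord0); rewrite mxE.
by move=> Ax i j; rewrite !ord1 mxE.
Qed.

Lemma integral_row_mx (m n1 n2 : nat) (g : 'M[R]_(m, n1 + n2) -> \bar R) :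
  measurable_fun setT g -> (forall X, 0 <= g X) ->
  \int[leb m (n1 + n2)]_X g X =
  \int[leb m n1 \x leb m n2]_p g (row_mx p.1 p.2).
Proof.
apply: lebesgue_mx_transfer; first exact: measurable_fun_row_mx.
move=> A mA.
transitivity ((leb m n1 \x leb m n2)
    (mx_box (fun i j => A i (lshift n2 j)) `*`
     mx_box (fun i j => A i (rshift n1 j)))).
  congr (product_measure1 _ _ _); apply/seteqP; split=> -[Y Z] /=.
    move=> AYZ; split=> i j.
      by have := AYZ i (lshift n2 j); rewrite row_mxEl.
    by have := AYZ i (rshift n1 j); rewrite row_mxEr.
  move=> [AY AZ] i j; case: (split_ordP j) => k ->.
    by rewrite row_mxEl; exact: AY.
  by rewrite row_mxEr; exact: AZ.
rewrite product_measure1E; [|exact: measurable_mx_box|exact: measurable_mx_box].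
transitivity ((\prod_(i < m) \prod_(j < n1) lambda (A i (lshift n2 j))) *
              (\prod_(i < m) \prod_(j < n2) lambda (A i (rshift n1 j)))).
  by congr (_ * _); exact: lebesgue_mx_box.
rewrite -big_split/=; apply: eq_bigr => i _; by rewrite big_split_ord.
Qed.

Lemma integral_col_mx (m1 m2 n : nat) (g : 'M[R]_(m1 + m2, n) -> \bar R) :
  measurable_fun setT g -> (forall X, 0 <= g X) ->
  \int[leb (m1 + m2) n]_X g X =
  \int[leb m1 n \x leb m2 n]_p g (col_mx p.1 p.2).
Proof.
apply: lebesgue_mx_transfer; first exact: measurable_fun_col_mx.
move=> A mA.
transitivity ((leb m1 n \x leb m2 n)
    (mx_box (fun i j => A (lshift m2 i) j) `*`
     mx_box (fun i j => A (rshift m1 i) j))).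
  congr (product_measure1 _ _ _); apply/seteqP; split=> -[Y Z] /=.
    move=> AYZ; split=> i j.
      by have := AYZ (lshift m2 i) j; rewrite col_mxEu.
    by have := AYZ (rshift m1 i) j; rewrite col_mxEd.
  move=> [AY AZ] i j; case: (split_ordP i) => k ->.
    by rewrite col_mxEu; exact: AY.
  by rewrite col_mxEd; exact: AZ.
rewrite product_measure1E; [|exact: measurable_mx_box|exact: measurable_mx_box].
transitivity ((\prod_(i < m1) \prod_(j < n) lambda (A (lshift m2 i) j)) *
              (\prod_(i < m2) \prod_(j < n) lambda (A (rshift m1 i) j))).
  by congr (_ * _); exact: lebesgue_mx_box.
by rewrite big_split_ord.
Qed.

End lebesgue_mx_integrals.

(** * Linear substitutions *)

Section linear_substitution.
Local Open Scope ereal_scope.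
Context (R : realType).
Local Notation leb m n := (@lebesgue_mx R m n).
Local Notation lambda := (@lebesgue_measure R).

Lemma integral_row_mx12 (m n1 n2 : nat) (g : 'M[R]_(m, n1 + n2) -> \bar R) :
  measurable_fun setT g -> (forall X, 0 <= g X) ->
  \int[leb m (n1 + n2)]_X g X =
  \int[leb m n1]_Y \int[leb m n2]_Z g (row_mx Y Z).
Proof.
move=> mg g0; rewrite integral_row_mx// fubini_tonelli1//.
by apply: measurableT_comp => //; exact: measurable_fun_row_mx.
Qed.

Lemma integral_row_mx21 (m n1 n2 : nat) (g : 'M[R]_(m, n1 + n2) -> \bar R) :
  measurable_fun setT g -> (forall X, 0 <= g X) ->
  \int[leb m (n1 + n2)]_X g X =
  \int[leb m n2]_Z \int[leb m n1]_Y g (row_mx Y Z).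
Proof.
move=> mg g0; rewrite integral_row_mx// fubini_tonelli2//.
by apply: measurableT_comp => //; exact: measurable_fun_row_mx.
Qed.

Lemma integral_col_mx12 (m1 m2 n : nat) (g : 'M[R]_(m1 + m2, n) -> \bar R) :
  measurable_fun setT g -> (forall X, 0 <= g X) ->
  \int[leb (m1 + m2) n]_X g X =
  \int[leb m1 n]_Y \int[leb m2 n]_Z g (col_mx Y Z).
Proof.
move=> mg g0; rewrite integral_col_mx// fubini_tonelli1//.
by apply: measurableT_comp => //; exact: measurable_fun_col_mx.
Qed.

Lemma integral_row_mxl_measurable (m n1 n2 : nat)
    (g : 'M[R]_(m, n1 + n2) -> \bar R) :
  measurable_fun setT g -> (forall X, 0 <= g X) ->
  measurable_fun setT (fun Y => \int[leb m n2]_Z g (row_mx Y Z)).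
Proof.
move=> mg g0.
apply: (@measurable_fun_fubini_tonelli_F _ _ _ _ R (leb m n2)
  (fun p : 'M[R]_(m, n1) * 'M[R]_(m, n2) => g (row_mx p.1 p.2))) => //.
by apply: measurableT_comp => //; exact: measurable_fun_row_mx.
Qed.

(** Phrased with integrals so that the class of such matrices is closed under
    products; only the factors of a Gaussian elimination need be treated. *)
Definition scales_volume (n : nat) (T : 'M[R]_n) :=
  forall g : 'rV[R]_n -> \bar R, measurable_fun setT g ->
  (forall x, 0 <= g x) ->
  \int[leb 1 n]_x g x = `|\det T|%:E * \int[leb 1 n]_x g (x *m T)%R.

Let measurable_comp_mulmxr (m n : nat) (T : 'M[R]_n)
    (g : 'M[R]_(m, n) -> \bar R) : measurable_fun setT g ->
  measurable_fun setT (fun X => g (X *m T)%R).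
Proof.
by move=> mg; apply: measurableT_comp => //; exact: measurable_fun_mulmx.
Qed.

Lemma scales_volume_mul (n : nat) (S T : 'M[R]_n) :
  scales_volume S -> scales_volume T -> scales_volume (S *m T)%R.
Proof.
move=> jS jT g mg g0; rewrite jT//.
rewrite (jS (fun x => g (x *m T)%R)) //; last exact: measurable_comp_mulmxr.
rewrite muleA det_mulmx normrM mulrC EFinM; congr (_ * _).
by apply: eq_integral => x _; rewrite mulmxA.
Qed.

Lemma scales_volume_perm (n : nat) (s : {perm 'I_n}) :
  scales_volume (perm_mx s : 'M[R]_n).
Proof.
move=> g mg g0; rewrite det_perm normr_sign mul1e.
rewrite (integral_col_perm (s^-1)%g)//; apply: eq_integral => x _.
by rewrite col_permE invgK.
Qed.

Lemma scales_volume_mx11 (u : 'M[R]_1) :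
  u ord0 ord0 != 0%R -> scales_volume u.
Proof.
move=> u0 g mg g0.
rewrite det_mx11 [in RHS]integral_const_mx; last 2 first.
  exact: measurable_comp_mulmxr.
  by move=> x; exact: g0.
pose v := u ord0 ord0.
have mphi : measurable_fun setT (fun x : R => const_mx (0 + v * x)%R : 'M[R]_1).
  apply: measurable_fun_mxP => i j; under eq_fun do rewrite mxE.
  exact: measurable_affine.
rewrite (@lebesgue_mx_transfer _ _ _ _ _ (mscale (NngNum (normr_ge0 v)) lambda)
  _ mphi)//.
  rewrite ge0_integral_mscale//=; last exact: measurableT_comp.
  congr (_ * _); apply: eq_integral => x _; congr g.
  apply/matrixP => i j; rewrite !ord1 !mxE big_ord1 mxE add0r.
  by rewrite mulrC.
move=> A mA; rewrite !big_ord1 /mscale /=.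
rewrite -[RHS](@lebesgue_measure_affine R 0 v _ u0 (mA _ _)).
congr (_ * _); congr lambda; apply/seteqP; split=> x /=.
  by move=> /(_ ord0 ord0); rewrite mxE.
by move=> Ax i j; rewrite !ord1 mxE.
Qed.

Lemma scales_volume_diag (n : nat) (u : 'M[R]_1) (T : 'M[R]_n) :
  scales_volume u -> scales_volume T ->
  scales_volume (block_mx u 0%R 0%R T : 'M[R]_(1 + n)).
Proof.
move=> ju jT g mg g0; rewrite det_ublock.
rewrite [LHS]integral_row_mx12// integral_row_mx12//; last first.
  exact: measurable_comp_mulmxr.
rewrite ju; last 2 first.
  exact: integral_row_mxl_measurable.
  by move=> Y; exact: integral_ge0.
rewrite normrM EFinM -muleA; congr (_ * _).
rewrite -ge0_integralZl//; last 2 first.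
  apply: (@integral_row_mxl_measurable 1 1 n
    (fun X => g (X *m (block_mx u 0%R 0%R T : 'M[R]_(1 + n)))%R)) => //.
  exact: measurable_comp_mulmxr.
  by move=> Y _; exact: integral_ge0.
apply: eq_integral => Y _.
rewrite (jT (fun Z => g (row_mx (Y *m u)%R Z)))//; last first.
  by apply: measurableT_comp => //; exact: measurable_fun_row_mx.
congr (_ * _); apply: eq_integral => Z _.
by rewrite mul_row_block !mulmx0 addr0 add0r.
Qed.

Lemma scales_volume_upper_shear (n : nat) (w : 'M[R]_(1, n)) :
  scales_volume (block_mx (1%:M)%R w 0%R (1%:M)%R : 'M[R]_(1 + n)).
Proof.
move=> g mg g0; rewrite det_ublock !det1 mulr1 normr1 mul1e.
rewrite [LHS]integral_row_mx12// integral_row_mx12//; last first.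
  exact: measurable_comp_mulmxr.
apply: eq_integral => Y _.
rewrite (integral_addmx (Y *m w)%R)//; last first.
  by apply: measurableT_comp => //; exact: measurable_fun_row_mx.
apply: eq_integral => Z _.
by rewrite mul_row_block !mulmx0 !mulmx1 addr0.
Qed.

Lemma scales_volume_lower_shear (n : nat) (w : 'M[R]_(n, 1)) :
  scales_volume (block_mx (1%:M)%R 0%R w (1%:M)%R : 'M[R]_(1 + n)).
Proof.
move=> g mg g0; rewrite det_lblock !det1 mulr1 normr1 mul1e.
rewrite [LHS]integral_row_mx21// integral_row_mx21//; last first.
  exact: measurable_comp_mulmxr.
apply: eq_integral => Z _.
rewrite (integral_addmx (Z *m w)%R)//; last first.
  by apply: measurableT_comp => //; exact: measurable_fun_row_mx.
apply: eq_integral => Y _.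
by rewrite mul_row_block !mulmx0 !mulmx1 add0r addrC.
Qed.

(** A permutation of the rows brings a nonzero pivot to the corner; the matrix
    is then a lower shear times a block diagonal matrix times an upper shear. *)
Lemma unitmx_scales_volume (n : nat) (T : 'M[R]_n) :
  T \in unitmx -> scales_volume T.
Proof.
elim: n T => [|n IHn] T.
  move=> _ g mg g0; rewrite det_mx00 normr1 mul1e.
  by apply: eq_integral => x _; congr g; apply/rowP => -[].
have pivot (S : 'M[R]_(1 + n)) : S \in unitmx -> S ord0 ord0 != 0%R ->
    scales_volume S.
  move=> uS S0; set a := S ord0 ord0 in S0.
  have aE : ulsubmx S = a%:M.
    apply/matrixP => i j; rewrite !ord1 !mxE eqxx; congr (S _ _);
    exact/val_inj.
  pose D := (drsubmx S - dlsubmx S *m (a^-1 *: ursubmx S))%R.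
  have SE : S = (block_mx 1%:M 0 (a^-1 *: dlsubmx S) 1%:M *m
      (block_mx a%:M 0 0 D *m block_mx 1%:M (a^-1 *: ursubmx S) 0 1%:M))%R.
    rewrite !mulmx_block !(mulmx0, mul0mx, mulmx1, mul1mx, addr0, add0r).
    rewrite -[LHS](submxK S) aE; congr block_mx.
    - by rewrite mul_scalar_mx scalerA divff// scale1r.
    - by rewrite -scalemxAl mul_mx_scalar scalerA mulVf// scale1r.
    - rewrite /D addrC mul_scalar_mx -scalemxAl.
      by rewrite -!scalemxAr !scalerA divff// mulr1 subrK.
  rewrite SE; apply: scales_volume_mul; first exact: scales_volume_lower_shear.
  apply: scales_volume_mul; last exact: scales_volume_upper_shear.
  apply: scales_volume_diag.
    by apply: scales_volume_mx11; rewrite mxE eqxx.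
  apply: IHn; move: uS.
  rewrite SE !unitmx_mul => /andP[_ /andP[+ _]].
  by rewrite 2!unitmxE det_ublock unitrM => /andP[].
move=> uT.
have [k Tk] : exists k, T k ord0 != 0%R.
  apply/existsP; apply: contraT; rewrite negb_exists => /forallP T0.
  move: uT; rewrite unitmxE (expand_det_col _ ord0) big1 ?unitr0// => i _.
  by have /negbNE/eqP-> := T0 i; rewrite mul0r.
rewrite -[T]mul1mx -perm_mx1 -(tperm2 ord0 k) perm_mxM -mulmxA.
apply: scales_volume_mul; first exact: scales_volume_perm.
apply: pivot; first by rewrite unitmx_mul unitmx_perm.
by rewrite -row_permE mxE tpermL.
Qed.

(** [X |-> X *m T] acts on each row of [X] separately. *)
Lemma integral_mulmxr (m n : nat) (T : 'M[R]_n) (g : 'M[R]_(m, n) -> \bar R) :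
  T \in unitmx -> measurable_fun setT g -> (forall X, 0 <= g X) ->
  \int[leb m n]_X g X = (`|\det T| ^+ m)%:E * \int[leb m n]_X g (X *m T)%R.
Proof.
move=> uT; elim: m g => [|m IHm] g mg g0.
  rewrite expr0 mul1e; apply: eq_integral => x _; congr g.
  by rewrite [LHS]flatmx0 [RHS]flatmx0.
rewrite -[m.+1]/(1 + m)%N in g mg g0 *.
rewrite [LHS]integral_col_mx12// integral_col_mx12//; last first.
  exact: measurable_comp_mulmxr.
rewrite (unitmx_scales_volume uT); last 2 first.
  apply: (@measurable_fun_fubini_tonelli_F _ _ _ _ R (leb m n)
    (fun p : 'M[R]_(1, n) * 'M[R]_(m, n) => g (col_mx p.1 p.2))) => //.
  by apply: measurableT_comp => //; exact: measurable_fun_col_mx.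
  by move=> Y; exact: integral_ge0.
rewrite exprS EFinM -muleA; congr (_ * _).
rewrite -ge0_integralZl//; last 2 first.
  apply: (@measurable_fun_fubini_tonelli_F _ _ _ _ R (leb m n)
    (fun p : 'M[R]_(1, n) * 'M[R]_(m, n) => g (col_mx p.1 p.2 *m T)%R)) => //.
  apply: measurableT_comp => //; apply: measurable_fun_mulmx => //.
  exact: measurable_fun_col_mx.
  by move=> Y _; exact: integral_ge0.
apply: eq_integral => Y _.
rewrite (IHm (fun Z => g (col_mx (Y *m T)%R Z)))//; last first.
  by apply: measurableT_comp => //; exact: measurable_fun_col_mx.
by congr (_ * _); apply: eq_integral => Z _; rewrite mul_col_mx.
Qed.

Lemma integral_mulmxl (m n : nat) (T : 'M[R]_m) (g : 'M[R]_(m, n) -> \bar R) :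
  T \in unitmx -> measurable_fun setT g -> (forall X, 0 <= g X) ->
  \int[leb m n]_X g X = (`|\det T| ^+ n)%:E * \int[leb m n]_X g (T *m X)%R.
Proof.
move=> uT mg g0; rewrite integral_trmx// (@integral_mulmxr _ _ (T^T)%R) //.
- rewrite det_tr; congr (_ * _); rewrite [RHS]integral_trmx//.
    by apply: eq_integral => X _; rewrite trmx_mul trmxK.
  by apply: measurableT_comp => //; exact: measurable_fun_mulmx.
- by rewrite unitmx_tr.
- by apply: measurableT_comp => //; exact: measurable_fun_trmx.
Qed.

End linear_substitution.

(** * Parametrizing tuples by the graph they span *)

Lemma finite_roots (R : realType) (p : {poly R}) :
  p != 0 -> finite_set [set t | root p t].
Proof.
have [n] := ubnP (size p); elim: n p => // n IHn p /ltnSE pn p0.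
have [[a ra]|nor] := pselect (exists a, root p a); last first.
  rewrite (_ : mkset _ = set0) //.
  by apply/seteqP; split=> // t rt; apply: nor; exists t.
have /factor_theorem[q pE] := ra.
have q0 : q != 0 by apply: contra p0 => /eqP q0; rewrite pE q0 mul0r.
apply: (@sub_finite_set _ _ ([set t | root q t] `|` [set a])).
  by move=> t /=; rewrite pE rootM root_XsubC => /orP[?|/eqP]; [left|right].
rewrite finite_setU; split => //; apply: IHn => //.
move: pn; rewrite pE size_Mmonic ?monicXsubC// size_XsubC addn2 /=.
by rewrite -ltnS.
Qed.

Section singular_negligible.
Local Open Scope ereal_scope.
Context (R : realType).
Local Notation leb m n := (@lebesgue_mx R m n).
Local Notation lambda := (@lebesgue_measure R).

Lemma measurable_det0 (m : nat) : measurable [set X : 'M[R]_m | \det X == 0%R].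
Proof.
have mdet : measurable_fun setT (fun X : 'M[R]_m => \det X).
  by apply: measurable_fun_det; exact: measurable_id.
rewrite (_ : mkset _ = setT `&` (fun X => \det X) @^-1` [set 0%R]).
  exact: mdet.
by rewrite setTI; apply/seteqP; split=> X /= /eqP.
Qed.

(** Averaging the translates [t%:M + X]: each line in the direction of the
    identity meets the singular matrices in the finitely many roots of a
    characteristic polynomial. *)
Lemma lebesgue_mx_det0 (m : nat) : leb m m [set X | \det X == 0%R] = 0.
Proof.
set N := mkset _; pose mN := @measurable_det0 m.
pose f (p : R * 'M[R]_m) : \bar R := (\1_N (p.1%:M + p.2)%R)%:E.
have mscal : measurable_fun setT (fun p : R * 'M[R]_m => (p.1%:M : 'M[R]_m)).
  apply: measurable_fun_mxP => i j; under eq_fun do rewrite mxE.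
  case: (i == j); last by under eq_fun do rewrite mulr0n; exact: measurable_cst.
  by under eq_fun do rewrite mulr1n; exact: measurable_fst.
have mf : measurable_fun setT f.
  apply/measurable_EFinP; apply: measurableT_comp => //.
  by apply: measurable_fun_addmx.
have f0 p : 0 <= f p by rewrite lee_fin.
have := @fubini_tonelli _ _ _ _ R lambda (leb m m) f mf f0.
under eq_integral => t _.
  rewrite -(@integral_addmx R m m t%:M (fun X => (\1_N X)%:E)); last 2 first.
    by apply/measurable_EFinP.
    by move=> X; rewrite lee_fin.
  rewrite integral_indic// setIT; over.
rewrite /= integral_cst//= => E.
have : leb m m N * lambda [set: R] = 0.
  rewrite E; apply: integral0_eq => X _.
  rewrite (_ : (fun _ => _) = (fun t => (\1_[set t | \det (t%:M + X)%R == 0%R] t)%:E))//.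
  have mD : measurable [set t : R | \det (t%:M + X)%R == 0%R].
    have mg : measurable_fun setT (fun t : R => (t%:M + X)%R).
      apply: measurable_fun_addmx => //.
      apply: measurable_fun_mxP => i j; under eq_fun do rewrite mxE.
      case: (i == j); last by under eq_fun do rewrite mulr0n; exact: measurable_cst.
      by under eq_fun do rewrite mulr1n; exact: measurable_id.
    have := mg measurableT _ (@measurable_det0 m).
    by rewrite setTI.
  rewrite integral_indic// setIT; apply: countable_lebesgue_measure0.
  apply: finite_set_countable.
  apply: (@sub_finite_set _ _ [set t | root (char_poly (- X)%R) t]).
    move=> t /= /det0P[v v0]; rewrite mulmxDr mul_mx_scalar => /eqP.
    rewrite addr_eq0 => /eqP vX.
    rewrite -eigenvalue_root_char; apply/eigenvalueP; exists v => //.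
    by rewrite mulmxN vX.
  by apply: finite_roots; rewrite monic_neq0// char_poly_monic.
move=> /eqP; rewrite mule_eq0 => /orP[/eqP//|].
by rewrite -set_itvNyy lebesgue_measure_itv/=.
Qed.

End singular_negligible.

Section blaschke_petkantschin.
Local Open Scope ereal_scope.
Context (R : realType).
Local Notation leb m n := (@lebesgue_mx R m n).
Local Notation lambda := (@lebesgue_measure R).

(** The linear Blaschke-Petkantschin formula, in the chart of the Grassmannian
    formed by the graphs of linear maps. For an invertible [Y] the substitution
    [Z = Y *m A] has Jacobian [|det Y|^k]; the singular [Y] are negligible. *)
Lemma blaschke_petkantschin (m k : nat) (g : 'M[R]_(m, m + k) -> \bar R) :
  measurable_fun setT g -> (forall X, 0 <= g X) ->
  \int[leb m (m + k)]_X g X =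
  \int[leb m k]_A \int[leb m m]_Y
    ((`|\det Y| ^+ k)%:E * g (row_mx Y (Y *m A)%R)).
Proof.
move=> mg g0; rewrite integral_row_mx12//.
pose f (p : 'M[R]_(m, m) * 'M[R]_(m, k)) : \bar R :=
  (`|\det p.1| ^+ k)%:E * g (row_mx p.1 (p.1 *m p.2)%R).
have mf : measurable_fun setT f.
  apply: emeasurable_funM.
    apply/measurable_EFinP; apply: measurable_funX.
    apply: measurableT_comp => //; exact: measurable_fun_det.
  apply: measurableT_comp => //; apply: measurable_fun_row_mx => //.
  exact: measurable_fun_mulmx.
have f0 p : 0 <= f p by rewrite mule_ge0// lee_fin exprn_ge0.
rewrite -(@fubini_tonelli _ _ _ _ R (leb m m) (leb m k) f mf f0).
apply: ge0_ae_eq_integral => //.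
- exact: integral_row_mxl_measurable.
- exact: (measurable_fun_fubini_tonelli_F f mf f0).
- by move=> Y _; exact: integral_ge0.
- by move=> Y _; exact: integral_ge0.
exists [set X : 'M[R]_m | \det X == 0%R]; split.
- exact: measurable_det0.
- exact: lebesgue_mx_det0.
move=> Y /=; apply: contra_notP => /negP Y0 _.
have uY : Y \in unitmx by rewrite unitmxE unitfE.
have mgY : measurable_fun setT (fun Z : 'M[R]_(m, k) => g (row_mx Y Z)).
  by apply: measurableT_comp => //; exact: measurable_fun_row_mx.
rewrite (integral_mulmxl uY mgY)//.
rewrite /fubini_F /f /= ge0_integralZl//.
- apply: measurableT_comp => //; apply: measurable_fun_row_mx => //.
  exact: measurable_fun_mulmx.
Qed.

Lemma integral_prod_rows (m n : nat) (h : 'rV[R]_n -> R) :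
  measurable_fun setT h -> (forall x, 0 <= h x)%R ->
  \int[leb m n]_X (\prod_(i < m) h (row i X))%R%:E =
  (\int[leb 1 n]_x (h x)%:E) ^+ m.
Proof.
move=> mh h0; elim: m => [|m IHm].
  under eq_integral do rewrite big_ord0.
  rewrite expe0 integral_cst// mul1e.
  have -> : [set: 'M[R]_(0, n)] = mx_box (fun _ _ => setT).
    by apply/seteqP; split=> // X _ [].
  by apply: etrans (lebesgue_mx_box _) _; rewrite ?big_ord0.
have mprod p : measurable_fun setT
    (fun X : 'M[R]_(p, n) => (\prod_(i < p) h (row i X))%R%:E).
  apply/measurable_EFinP; apply: measurable_prod => i _.
  by apply: measurableT_comp => //; exact: measurable_fun_row.
have prod0 p (X : 'M[R]_(p, n)) : 0 <= (\prod_(i < p) h (row i X))%R%:E.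
  by rewrite lee_fin prodr_ge0.
rewrite -[m.+1]/(1 + m)%N integral_col_mx12//.
transitivity (\int[leb 1 n]_Y ((h Y)%:E * (\int[leb 1 n]_x (h x)%:E) ^+ m)).
  apply: eq_integral => Y _; rewrite -IHm -ge0_integralZl//; last first.
    by rewrite lee_fin.
  exact: mprod.
  apply: eq_integral => Z _.
  rewrite big_split_ord big_ord1 -EFinM/=; congr (_ * _)%:E; last first.
    by apply: eq_bigr => i _; congr h; apply/rowP => j; rewrite [LHS]mxE col_mxEd [RHS]mxE.
  by congr h; apply/rowP => j; rewrite mxE col_mxEu.
rewrite ge0_integralZr//.
- by rewrite expeS.
- exact/measurable_EFinP.
- by move=> x _; rewrite lee_fin.
- by rewrite expe_ge0// integral_ge0// => x _; rewrite lee_fin.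
Qed.

Lemma integral_prod_entries (m n : nat) (h : R -> R) :
  measurable_fun setT h -> (forall x, 0 <= h x)%R ->
  \int[leb m n]_X (\prod_(i < m) \prod_(j < n) h (X i j))%R%:E =
  (\int[lambda]_x (h x)%:E) ^+ (m * n).
Proof.
move=> mh h0.
have mcoord (p q : nat) i j :
    measurable_fun setT (fun X : 'M[R]_(p, q) => h (X i j)).
  by apply: measurableT_comp => //; exact: measurable_coord.
have := @integral_prod_rows m n (fun x => \prod_(j < n) h (x ord0 j))%R.
under eq_integral do under eq_bigr do under eq_bigr do rewrite mxE.
move=> ->; last 2 first.
  by apply: measurable_prod => j _; exact: mcoord.
  by move=> x; rewrite prodr_ge0.
suff -> : \int[leb 1 n]_x (\prod_(j < n) h (x ord0 j))%R%:E =
          (\int[lambda]_x (h x)%:E) ^+ n.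
  elim: m => [|m IHm]; first by rewrite expe0 mul0n.
  rewrite expeS IHm mulSn; move: (m * n)%N => p.
  elim: n {IHm} => [|n IHn]; first by rewrite mul1e.
  by rewrite addSn !expeS -muleA IHn.
rewrite integral_trmx; last 2 first.
  by apply/measurable_EFinP; apply: measurable_prod => j _; exact: mcoord.
  by move=> x; rewrite lee_fin prodr_ge0.
have := @integral_prod_rows n 1 (fun x => h (x ord0 ord0)).
under eq_integral do under eq_bigr do rewrite mxE.
under [in X in _ -> X]eq_integral do under eq_bigr do rewrite mxE.
move=> ->//.
rewrite integral_const_mx.
- by under eq_integral do rewrite mxE.
- by apply/measurable_EFinP; exact: mcoord.
- by move=> X; rewrite lee_fin.
Qed.

End blaschke_petkantschin.

(** * Gaussian weights and the Gram matrix of a graph *)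

Lemma trmulmx_ge0 (R : realDomainType) (m n : nat) (X : 'M[R]_(m, n)) :
  0 <= \tr (X *m X^T).
Proof.
rewrite /mxtrace sumr_ge0// => i _; rewrite mxE sumr_ge0// => j _.
by rewrite mxE -expr2 sqr_ge0.
Qed.

Section gaussian.
Context (R : realType).

Definition gauss_mx (s : R) (m n : nat) (X : 'M[R]_(m, n)) : R :=
  expR (- (pi * s ^+ 2 * \tr (X *m X^T))).

Lemma gauss_mx_ge0 s m n (X : 'M[R]_(m, n)) : 0 <= gauss_mx s X.
Proof. exact: expR_ge0. Qed.

Lemma measurable_fun_gauss_mx d (T : measurableType d) s m n
    (f : T -> 'M[R]_(m, n)) :
  measurable_fun setT f -> measurable_fun setT (fun t => gauss_mx s (f t)).
Proof.
move=> mf; rewrite /gauss_mx.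
apply: measurableT_comp => //; apply: (measurableT_comp (@oppr_measurable R setT)).
apply: measurable_funM => //; rewrite /mxtrace; apply: measurable_sum => i.
apply: measurable_fun_coord; apply: measurable_fun_mulmx => //.
exact: measurable_fun_trmx.
Qed.

Lemma integral_gauss (s : R) : 0 < s ->
  (\int[@lebesgue_measure R]_x (expR (- (pi * s ^+ 2 * x ^+ 2)))%:E =
   (s^-1)%:E)%E.
Proof.
move=> s0; pose u := s * Num.sqrt pi.
have u0 : 0 < u by rewrite mulr_gt0// sqrtr_gt0 pi_gt0.
have mg : measurable_fun setT (fun x : R => (gauss_fun x)%:E).
  by apply/measurable_EFinP; exact: measurable_gauss_fun.
have u0' : (const_mx u : 'M[R]_1) ord0 ord0 != 0 by rewrite mxE gt_eqF.
have mX : measurable_fun setT (fun X : 'M[R]_1 => (gauss_fun (X ord0 ord0))%:E).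
  by apply: (measurableT_comp mg); exact: measurable_coord.
have g0 X : (0 <= (gauss_fun ((X : 'M[R]_1) ord0 ord0))%:E)%E.
  by rewrite lee_fin gauss_fun_ge0.
have := @scales_volume_mx11 R (const_mx u) u0' _ mX g0.
rewrite det_mx11 mxE gtr0_norm//.
rewrite integral_const_mx//.
under eq_integral do rewrite mxE.
rewrite integralT_gauss integral_const_mx; last 2 first.
  by apply: (measurableT_comp mX); exact: measurable_fun_mulmx.
  by move=> X; rewrite lee_fin gauss_fun_ge0.
under eq_integral => x _.
  rewrite mxE big_ord1 !mxE /gauss_fun.
  rewrite (_ : (x * u) ^+ 2 = pi * s ^+ 2 * x ^+ 2); last first.
    by rewrite /u !exprMn sqr_sqrtr ?pi_ge0// mulrC (mulrC pi).
  over.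
move=> /(congr1 (fun z => (u^-1)%:E * z)%E).
rewrite muleA -!EFinM mulVf ?gt_eqF// mul1e => <-.
by rewrite /u invfM divfK// gt_eqF// sqrtr_gt0 pi_gt0.
Qed.

Lemma integral_gauss_mx (s : R) (m n : nat) : 0 < s ->
  (\int[@lebesgue_mx R m n]_X (gauss_mx s X)%:E = (s^-1 ^+ (m * n))%:E)%E.
Proof.
move=> s0; rewrite EFin_expe -integral_gauss// -integral_prod_entries.
- apply: eq_integral => X _; congr EFin; rewrite /gauss_mx /mxtrace.
  rewrite mulr_sumr -sumrN expR_sum; apply: eq_bigr => i _.
  rewrite mxE mulr_sumr -sumrN expR_sum; apply: eq_bigr => j _.
  by rewrite mxE -expr2.
- apply: measurableT_comp => //; apply: (measurableT_comp (@oppr_measurable R setT)).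
  by apply: measurable_funM => //; exact: measurable_funX.
- by move=> x; exact: expR_ge0.
Qed.

End gaussian.

Section graph_gram.
Context (R : realType).

(** Gram matrix of the rows of [row_mx 1%:M A], a basis of the graph of [A]. *)
Definition graph_gram (m k : nat) (A : 'M[R]_(m, k)) : 'M[R]_m :=
  1%:M + A *m A^T.

(** The factor by which the projection of the graph of [A] onto the first [m]
    coordinates contracts [m]-dimensional volume. *)
Definition graph_factor (m k : nat) (A : 'M[R]_(m, k)) : R :=
  (Num.sqrt (\det (graph_gram A)))^-1.

Definition graph_space (m k : nat) (A : 'M[R]_(m, k)) :
    {vspace 'rV[R]_(m + k)} :=
  <<[tuple row i (row_mx 1%:M A) | i < m]>>%VS.

Lemma mem_graph_space (m k : nat) (A : 'M[R]_(m, k)) (x : 'rV[R]_(m + k)) :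
  (x \in graph_space A) = (x == lsubmx x *m row_mx 1%:M A).
Proof.
apply/idP/eqP => [|->]; last first.
  rewrite mulmx_sum_row; apply: memv_suml => i _; apply: memvZ.
  apply: memv_span.
  by have := mem_tnth i [tuple row i (row_mx 1%:M A) | i < m];
     rewrite tnth_mktuple.
move=> /coord_span xE.
suff [c ->] : exists c, x = c *m row_mx 1%:M A.
  suff -> : lsubmx (c *m row_mx 1%:M A) = c by [].
  by rewrite mul_mx_row row_mxKl mulmx1.
exists (\row_i coord [tuple row i (row_mx 1%:M A) | i < m] i x).
rewrite mulmx_sum_row [LHS]xE; apply: eq_bigr => i _.
by rewrite mxE -tnth_nth tnth_mktuple.
Qed.

Lemma dim_graph_space (m k : nat) (A : 'M[R]_(m, k)) : \dim (graph_space A) = m.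
Proof.
rewrite /graph_space.
have /eqP -> : free [tuple row i (row_mx 1%:M A) | i < m]; last first.
  by rewrite size_tuple.
apply/freeP => c cE i.
have : (\row_j c j) *m row_mx 1%:M A = 0.
  rewrite mulmx_sum_row -[RHS]cE; apply: eq_bigr => j _.
  by rewrite mxE -tnth_nth tnth_mktuple.
move=> /(congr1 lsubmx); rewrite mul_mx_row row_mxKl mulmx1.
by move=> /rowP/(_ i); rewrite !mxE.
Qed.

(** An orthonormal basis of the graph is determined by its first [m] columns
    [T], and orthonormality says that [T] reduces the Gram matrix to the
    identity. *)
Lemma orthonormal_graph_basis (m k : nat) (A : 'M[R]_(m, k))
    (B : 'M[R]_(\dim (graph_space A), m + k)) :
  B = orthonormal_basis (graph_space A) ->
  B = lsubmx B *m row_mx 1%:M A /\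
  lsubmx B *m graph_gram A *m (lsubmx B)^T = 1%:M.
Proof.
move=> ->; have [BB /andP[/eqP BF _]] := orthonormal_basisP (graph_space A).
set B' := orthonormal_basis _ in BB BF *.
have BE : B' = lsubmx B' *m row_mx 1%:M A.
  apply/row_matrixP => i; rewrite row_mul.
  have : row i B' \in graph_space A.
    have : row i B' \in <<[tuple row i B' | i < \dim (graph_space A)]>>%VS.
      apply: memv_span.
      by have := mem_tnth i [tuple row i B' | i < \dim (graph_space A)];
         rewrite tnth_mktuple.
    by rewrite BF.
  rewrite mem_graph_space => /eqP {1}->; congr (_ *m _).
  by apply/rowP => j; rewrite !mxE.
split=> //; move: BB; rewrite {1 2}BE trmx_mul => <-.
rewrite -!mulmxA; congr mulmx; rewrite !mulmxA; congr mulmx.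
by rewrite tr_row_mx mul_row_col trmx1 mulmx1.
Qed.

Lemma graph_gram_factorization (m k : nat) (A : 'M[R]_(m, k)) :
  exists T : 'M[R]_m, T *m graph_gram A *m T^T = 1%:M.
Proof.
have [] := @orthonormal_graph_basis m k A _ erefl.
move: (orthonormal_basis _) => B; move: (lsubmx B) => T _.
by move: T; rewrite dim_graph_space => T TE; exists T.
Qed.

Lemma graph_factorE (m k : nat) (A : 'M[R]_(m, k)) (T : 'M[R]_m) :
  T *m graph_gram A *m T^T = 1%:M -> `|\det T| = graph_factor A.
Proof.
move=> /(congr1 determinant); rewrite !det_mulmx det_tr det1 => dT.
have {}dT : \det T ^+ 2 * \det (graph_gram A) = 1.
  by rewrite -dT expr2 mulrAC.
have T0 : \det T != 0.
  by apply/eqP => T0; move: dT; rewrite T0 expr0n mul0r => /esym/eqP;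
     rewrite oner_eq0.
have -> : graph_factor A = (Num.sqrt ((\det T ^+ 2)^-1))^-1.
  by congr (Num.sqrt _)^-1; apply: (mulfI (expf_neq0 2 T0)); rewrite dT divff// expf_neq0.
by rewrite -exprVn sqrtr_sqr normfV invrK.
Qed.

Lemma graph_factor_gt0 (m k : nat) (A : 'M[R]_(m, k)) : 0 < graph_factor A.
Proof.
have [T TE] := graph_gram_factorization A.
rewrite -(graph_factorE TE) normr_gt0 -unitfE -unitmxE.
by have /mulmx1_unit[] : T *m (graph_gram A *m T^T) = 1%:M by rewrite mulmxA.
Qed.

(** Both sides are the determinant of one bordered matrix, eliminated from
    either corner. *)
Lemma det_graph_gram_col (m : nat) (a : 'M[R]_(m, 1)) :
  \det (graph_gram a) = 1 + \tr (a *m a^T).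
Proof.
pose S := block_mx 1%:M a (- a^T) 1%:M : 'M[R]_(m + 1).
have S1 : S = block_mx 1%:M 0 (- a^T) 1%:M *m
    block_mx 1%:M a 0 (1%:M + a^T *m a) :> 'M[R]_(m + 1).
  rewrite mulmx_block !(mulmx0, mul0mx, mulmx1, mul1mx, addr0, add0r).
  by rewrite mulNmx addrCA addNr addr0.
have S2 : S = block_mx (graph_gram a) a 0 1%:M *m
    block_mx 1%:M 0 (- a^T) 1%:M :> 'M[R]_(m + 1).
  rewrite mulmx_block !(mulmx0, mul0mx, mulmx1, mul1mx, addr0, add0r).
  by rewrite mulmxN addrK.
have : \det S = \det S by [].
rewrite {1}S2 S1 !det_mulmx !det_ublock !det_lblock !det1 !mulr1 !mul1r => ->.
rewrite mxtrace_mulC det_mx11 2!mxE.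
by rewrite /mxtrace big_ord1 eqxx.
Qed.

End graph_gram.

(** * Gaussian moments of the determinant *)

Section gauss_moment.
Local Open Scope ereal_scope.
Context (R : realType).
Local Notation leb m n := (@lebesgue_mx R m n).

Definition gauss_det_moment (m k : nat) : \bar R :=
  \int[leb m m]_Y (`|\det Y| ^+ k * gauss_mx 1 Y)%:E.

Lemma gauss_det_moment_ge0 m k : 0 <= gauss_det_moment m k.
Proof.
by apply: integral_ge0 => Y _; rewrite lee_fin mulr_ge0 ?exprn_ge0 ?gauss_mx_ge0.
Qed.

Lemma measurable_fun_normdetX (m k : nat) d (T : measurableType d)
  (f : T -> 'M[R]_m) : measurable_fun setT f ->
  measurable_fun setT (fun t => `|\det (f t)| ^+ k)%R.
Proof.
move=> mf; apply: measurable_funX; apply: measurableT_comp => //.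
exact: measurable_fun_det.
Qed.

(** The substitution [Y = Y' *m T] that makes the graph basis orthonormal turns
    the Gaussian of the graph into the standard one. The Jacobian gives [m]
    powers of the factor, and [|det Y|^k] gives [k] more. *)
Lemma gauss_fiber (m k : nat) (A : 'M[R]_(m, k)) :
  \int[leb m m]_Y ((`|\det Y| ^+ k)%:E * (gauss_mx 1 (row_mx Y (Y *m A)))%:E) =
  (graph_factor A ^+ (m + k))%:E * gauss_det_moment m k.
Proof.
have [T TE] := graph_gram_factorization A.
have uT : T \in unitmx.
  by have /mulmx1_unit[] : T *m (graph_gram A *m T^T) = 1%:M
    by rewrite mulmxA.
rewrite (integral_mulmxr uT).
- rewrite (graph_factorE TE) exprD EFinM -muleA; congr (_ * _).
  rewrite /gauss_det_moment -ge0_integralZl//.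
  + apply: eq_integral => Y _; rewrite -!EFinM; congr EFin.
    rewrite det_mulmx normrM exprMn (graph_factorE TE) mulrCA mulrA.
    congr (_ * _)%R; rewrite /gauss_mx; congr (expR (- (_ * _))).
    congr (\tr _); pose G := row_mx 1%:M A.
    have GG : (G *m G^T = graph_gram A)%R.
      by rewrite tr_row_mx mul_row_col trmx1 mulmx1.
    have -> : row_mx (Y *m T) (Y *m T *m A) = (Y *m (T *m G))%R.
      by rewrite !mul_mx_row mulmx1 mulmxA.
    transitivity (Y *m (T *m (G *m G^T) *m T^T) *m Y^T)%R.
      by rewrite !trmx_mul !mulmxA.
    by rewrite GG TE mulmx1.
  + apply/measurable_EFinP; apply: measurable_funM.
      exact: measurable_fun_normdetX.
    exact: measurable_fun_gauss_mx.
  + by move=> Y _; rewrite lee_fin mulr_ge0 ?exprn_ge0 ?gauss_mx_ge0.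
  + by rewrite lee_fin exprn_ge0// ltW// graph_factor_gt0.
- apply: emeasurable_funM; apply/measurable_EFinP.
    exact: measurable_fun_normdetX.
  apply: measurable_fun_gauss_mx; apply: measurable_fun_row_mx => //.
  exact: measurable_fun_mulmx.
- by move=> Y; rewrite -EFinM lee_fin mulr_ge0 ?exprn_ge0 ?gauss_mx_ge0.
Qed.

Lemma gauss_fiber_measurable (m k : nat) :
  measurable_fun setT (fun A : 'M[R]_(m, k) =>
    (graph_factor A ^+ (m + k))%:E * gauss_det_moment m k).
Proof.
under eq_fun do rewrite -gauss_fiber.
apply: (@measurable_fun_fubini_tonelli_F _ _ _ _ R (leb m m)
  (fun p : 'M[R]_(m, k) * 'M[R]_m =>
   (`|\det p.2| ^+ k)%:E * (gauss_mx 1 (row_mx p.2 (p.2 *m p.1)))%:E)) => //.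
  apply: emeasurable_funM; apply/measurable_EFinP.
    exact: measurable_fun_normdetX.
  apply: measurable_fun_gauss_mx; apply: measurable_fun_row_mx => //.
  exact: measurable_fun_mulmx.
by move=> p; rewrite -EFinM lee_fin mulr_ge0 ?exprn_ge0 ?gauss_mx_ge0.
Qed.

(** [blaschke_petkantschin] for a Gaussian of total mass one. *)
Lemma integral_graph_factor (m k : nat) :
  \int[leb m k]_A ((graph_factor A ^+ (m + k))%:E * gauss_det_moment m k) = 1.
Proof.
under eq_integral do rewrite -gauss_fiber.
rewrite -(@blaschke_petkantschin R m k (fun X => (gauss_mx 1 X)%:E)).
- by rewrite integral_gauss_mx// invr1 expr1n.
- by apply/measurable_EFinP; exact: measurable_fun_gauss_mx.
- by move=> X; rewrite lee_fin gauss_mx_ge0.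
Qed.

(** For a column [a] the factor is [(1 + |a|^2)^(-1/2)]; on the shell
    [4^j <= 1 + |a|^2 < 4^(j+1)] it is compared with a Gaussian of width
    [2^j / sqrt m]. *)
Lemma graph_factor_col_le (m : nat) (a : 'M[R]_(m, 1)) : (0 < m)%N ->
  exists j, (graph_factor a ^+ (m + 1) <= expR (4 * pi * m%:R) *
    2^-1 ^+ (j * (m + 1)) * gauss_mx (Num.sqrt m%:R / 2 ^+ j) a)%R.
Proof.
move=> m0; rewrite /graph_factor det_graph_gram_col.
set r := (\tr (a *m a^T))%R; have r0 : (0 <= r)%R by exact: trmulmx_ge0.
have [j jr rj] : exists2 j, (4 ^+ j <= 1 + r)%R & (1 + r < 4 ^+ j.+1)%R.
  have [N Nr] : exists N, (1 + r < 4 ^+ N)%R.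
    exists (Num.truncn (1 + r)).+1; apply: (lt_le_trans (truncnS_gt _)).
    rewrite -natrX ler_nat; apply: ltnW; exact: ltn_expl.
  elim: N Nr => [|N IHN] Nr.
    by move: Nr; rewrite expr0 ltNge lerDl r0.
  by have [/IHN//|Nr'] := ltP (1 + r)%R (4 ^+ N)%R; exists N.
exists j.
have r1 : (0 < 1 + r)%R by rewrite ltr_pwDl.
have s2j : (2 ^+ j <= Num.sqrt (1 + r))%R.
  have -> : (2 ^+ j = Num.sqrt (4 ^+ j) :> R)%R.
    rewrite (_ : 4 = 2 ^+ 2)%R; last by rewrite -natrX.
    by rewrite -exprM mulnC exprM sqrtr_sqr ger0_norm// exprn_ge0.
  by rewrite ler_wsqrtr.
apply: (@le_trans _ _ (2^-1 ^+ (j * (m + 1)))%R).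
  rewrite exprM lerXn2r ?nnegrE ?exprn_ge0 ?invr_ge0 ?sqrtr_ge0//.
  by rewrite exprVn lef_pV2 ?posrE ?exprn_gt0// sqrtr_gt0.
rewrite mulrAC ler_peMl ?exprn_ge0 ?invr_ge0// /gauss_mx -expRD.
rewrite -[X in (X <= _)%R]expR0 ler_expR.
have e4 : ((2 ^+ j) ^+ 2 = 4 ^+ j :> R)%R.
  by rewrite -exprM mulnC exprM -natrX.
rewrite subr_ge0 expr_div_n sqr_sqrtr ?ler0n// e4 -/r.
rewrite (_ : pi * (m%:R / 4 ^+ j) * r = (pi * m%:R) * (r / 4 ^+ j))%R; last first.
  by rewrite !mulrA mulrAC.
rewrite (_ : 4 * pi * m%:R = (pi * m%:R) * 4)%R; last by rewrite -mulrA mulrC.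
rewrite ler_wpM2l ?mulr_ge0 ?pi_ge0 ?ler0n//.
rewrite ler_pdivrMr ?exprn_gt0// -exprS.
by rewrite (le_trans _ (ltW rj))// lerDr.
Qed.

(** For columns, [integral_graph_factor] says that the first moment is the
    inverse of the integral of [(1 + |a|^2)^(-(m+1)/2)]; that integral is
    bounded above by summing Gaussian integrals over dyadic shells. *)
Lemma gauss_det_moment1_ge (m : nat) : (0 < m)%N ->
  ((expR (- (4 * pi)) / 2 * Num.sqrt m%:R) ^+ m)%:E <= gauss_det_moment m 1.
Proof.
move=> m0; set E := gauss_det_moment m 1.
have E0 : 0 <= E by exact: gauss_det_moment_ge0.
have sm0 : (0 < Num.sqrt (m%:R : R))%R by rewrite sqrtr_gt0 ltr0n.
(* the integrals of the [G j] decrease like [2^-j] *)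
pose c j : R := (expR (4 * pi * m%:R) * 2^-1 ^+ (j * (m + 1)))%R.
pose G j (a : 'M[R]_(m, 1)) := (c j * gauss_mx (Num.sqrt m%:R / 2 ^+ j) a)%:E.
have c0 j : (0 <= c j)%R by rewrite mulr_ge0 ?expR_ge0 ?exprn_ge0 ?invr_ge0.
have G0 j a : 0 <= G j a.
  by rewrite lee_fin mulr_ge0 ?gauss_mx_ge0.
have mG j : measurable_fun setT (G j).
  apply/measurable_EFinP; apply: measurable_funM => //.
  exact: measurable_fun_gauss_mx.
have IG j : \int[leb m 1]_a G j a =
    (expR (4 * pi * m%:R) * (Num.sqrt m%:R)^-1 ^+ m * (2^-1) ^+ j)%:E.
  under eq_integral do rewrite /G EFinM.
  rewrite ge0_integralZl//; last 3 first.
    by apply/measurable_EFinP; exact: measurable_fun_gauss_mx.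
    by move=> a _; rewrite lee_fin gauss_mx_ge0.
    by rewrite lee_fin.
  rewrite integral_gauss_mx ?divr_gt0 ?exprn_gt0// -EFinM; congr EFin.
  rewrite /c muln1 invfM invrK exprMn -!mulrA; congr (_ * _)%R.
  rewrite mulrCA; congr (_ * _)%R.
  rewrite mulnDr muln1 exprD mulrAC -exprM -exprMn.
  by rewrite mulVf ?pnatr_eq0// expr1n mul1r.
have : 1 <= (expR (4 * pi * m%:R) * (Num.sqrt m%:R)^-1 ^+ m * 2)%:E * E.
  rewrite -{1}(integral_graph_factor m 1) -/E.
  have -> : (expR (4 * pi * m%:R) * (Num.sqrt m%:R)^-1 ^+ m * 2)%:E =
      \int[leb m 1]_a (\sum_(0 <= j <oo) G j a).
    rewrite integral_nneseries//.
    under eq_eseriesr do rewrite IG.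
    apply/esym/cvg_lim => //.
    set C := (expR _ * _)%R.
    rewrite (_ : (fun _ => _) = EFin \o series (geometric C 2^-1)); last first.
      by apply/funext => n; rewrite /series /= sumEFin.
    apply: cvg_EFin; first by near=> n.
    rewrite (_ : C * 2 = C / (1 - 2^-1))%R; last first.
      by rewrite [X in (X - _)%R](splitr 1) mul1r addrK invrK.
    apply: cvg_geometric_series.
    by rewrite ger0_norm ?invr_ge0// invf_lt1// ltr1n.
  rewrite -ge0_integralZr//; last 2 first.
    by apply: ge0_emeasurable_sum.
    by move=> a _; exact: nneseries_ge0.
  apply: ge0_le_integral => //.
  - by move=> a _; rewrite mule_ge0// lee_fin exprn_ge0// ltW// graph_factor_gt0.
  - exact: gauss_fiber_measurable.
  - by apply: emeasurable_funM => //; exact: ge0_emeasurable_sum.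
  move=> a _; apply: lee_wpmul2r => //.
  have [j ja] := graph_factor_col_le a m0.
  apply: (@le_trans _ _ (G j a)); first by rewrite lee_fin.
  apply: le_trans (@nneseries_lim_ge R (G ^~ a) xpredT 0 j.+1
    (fun n _ _ => G0 n a)).
  by rewrite big_nat_recr//= leeDr// sume_ge0.
set Q := (expR _ * _ * 2)%R => QE.
have Q0 : (0 < Q)%R.
  by rewrite !mulr_gt0 ?expR_gt0// exprn_gt0// invr_gt0.
apply: (@le_trans _ _ (Q^-1)%:E); last first.
  by rewrite -(@lee_pmul2l _ Q%:E)// -EFinM mulfV ?gt_eqF.
have -> : (Q^-1 = 2^-1 * (expR (- (4 * pi)) ^+ m * Num.sqrt m%:R ^+ m))%R.
  rewrite /Q !invfM -exprVn invrK -expRN -mulNr mulrC; congr (_ * (_ * _))%R.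
  by rewrite -expRM_natl mulrC.
rewrite lee_fin !exprMn mulrAC [leLHS]mulrC ler_wpM2r//.
case: m m0 {sm0 c G c0 G0 mG IG E E0 Q QE Q0} => // m _.
by rewrite exprS ler_piMr ?invr_ge0// exprn_ile1 ?invr_ge0// invf_le1// ler1n.
Unshelve. all: by end_near.
Qed.

End gauss_moment.

(** A power lies above its tangent line at [a]. *)
Lemma expr_tangent_le (R : realDomainType) (x a : R) (j : nat) :
  0 <= x -> 0 <= a ->
  j.+1%:R * a ^+ j * x <= x ^+ j.+1 + j%:R * a ^+ j.+1.
Proof.
move=> x0 a0; elim: j => [|j IHj]; first by rewrite mul0r addr0 !mul1r.
have := ler_wpM2r x0 IHj; rewrite -subr_ge0 => H1.
have H2 : 0 <= j.+1%:R * a ^+ j * (x - a) ^+ 2.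
  by apply: mulr_ge0; [rewrite mulr_ge0 ?exprn_ge0|exact: sqr_ge0].
rewrite -subr_ge0; apply: le_trans (addr_ge0 H1 H2) _.
rewrite le_eqVlt; apply/orP; left; apply/eqP.
rewrite [x ^+ j.+2]exprSr [a ^+ j.+2]exprS [a ^+ j.+1]exprS.
rewrite -[j.+2]addn1 -[j.+1]addn1 !natrD.
move: (j%:R : R) (a ^+ j) (x ^+ (j + 1)) => J A X; ring.
Qed.

Lemma weighted_AGM (R : realFieldType) (m k : nat) (x y : R) :
  0 <= x -> 0 <= y -> (0 < m + k)%N ->
  (m + k)%:R * (x ^+ k * y ^+ m) <= k%:R * x ^+ (m + k) + m%:R * y ^+ (m + k).
Proof.
move=> x0 y0 mk0.
pose E (i : 'I_(m + k)) := match fintype.split i with inl _ => y ^+ (m + k)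
                                            | inr _ => x ^+ (m + k) end.
have E0 i : i \in 'I_(m + k) -> 0 <= E i.
  by move=> _; rewrite /E; case: fintype.split => _; exact: exprn_ge0.
have := (leif_AGM E0).1; rewrite card_ord.
have El i : E (lshift k i) = y ^+ (m + k).
  by rewrite /E -[lshift k i]/(unsplit (inl i)) unsplitK.
have Er i : E (rshift m i) = x ^+ (m + k).
  by rewrite /E -[rshift m i]/(unsplit (inr i)) unsplitK.
rewrite !big_split_ord /=.
under eq_bigr do rewrite El.
under [X in _ * X <= _ -> _]eq_bigr do rewrite Er.
under [X in _ <= ((X + _) / _) ^+ _ -> _]eq_bigr do rewrite El.
under [X in _ <= ((_ + X) / _) ^+ _ -> _]eq_bigr do rewrite Er.
rewrite !prodr_const !sumr_const !card_ord -!exprM mulnC (mulnC _ k) !exprM -exprMn.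
rewrite ler_pXn2r ?nnegrE//; last 2 first.
  by rewrite mulr_ge0 ?exprn_ge0.
  by rewrite divr_ge0// addr_ge0// mulrn_wge0// exprn_ge0.
rewrite ler_pdivlMr ?ltr0n// => H.
by rewrite mulrC (mulrC (x ^+ k)) addrC !mulr_natl.
Qed.

Section gauss_moment_lower_bound.
Local Open Scope ereal_scope.
Context (R : realType).
Local Notation leb m n := (@lebesgue_mx R m n).

(** By convexity of powers the moment of order [k] is at least the [k]-th power
    of the first moment. *)
Lemma gauss_det_moment_ge (m k : nat) : (0 < m)%N -> (0 < k)%N ->
  ((expR (- (4 * pi)) / 2 * Num.sqrt m%:R) ^+ (m * k))%:E <=
  gauss_det_moment R m k.
Proof.
move=> m0; case: k => // j _.
have := @gauss_det_moment1_ge R m m0; rewrite exprM.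
set a := (_ ^+ m)%R => aM.
have a0 : (0 <= a)%R by rewrite exprn_ge0// mulr_ge0 ?sqrtr_ge0// divr_ge0// expR_ge0.
have mgm (c : R) k : measurable_fun setT (fun Y : 'M[R]_m =>
    (c * (`|\det Y| ^+ k * gauss_mx 1 Y))%:E).
  apply/measurable_EFinP; apply: measurable_funM => //.
  by apply: measurable_funM; [exact: measurable_fun_normdetX|
    exact: measurable_fun_gauss_mx].
have gm0 k (Y : 'M[R]_m) : (0 <= `|\det Y| ^+ k * gauss_mx 1 Y)%R.
  by rewrite mulr_ge0 ?exprn_ge0 ?gauss_mx_ge0.
have Zm (c : R) k : (0 <= c)%R ->
    \int[leb m m]_Y (c * (`|\det Y| ^+ k * gauss_mx 1 Y))%:E =
    c%:E * gauss_det_moment R m k.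
  move=> c0; under eq_integral do rewrite EFinM.
  rewrite ge0_integralZl//.
  - by have := mgm 1%R k; under eq_fun do rewrite mul1r.
  - by move=> Y _; rewrite lee_fin.
have M0 : gauss_det_moment R m 0 = 1.
  rewrite /gauss_det_moment; under eq_integral do rewrite expr0 mul1r.
  by rewrite integral_gauss_mx// invr1 expr1n.
have : (j.+1%:R * a ^+ j)%:E * gauss_det_moment R m 1 <=
    gauss_det_moment R m j.+1 + (j%:R * a ^+ j.+1)%:E.
  rewrite -Zm ?mulr_ge0 ?exprn_ge0//.
  have -> : gauss_det_moment R m j.+1 + (j%:R * a ^+ j.+1)%:E =
      \int[leb m m]_Y (1 * (`|\det Y| ^+ j.+1 * gauss_mx 1 Y))%:E +
      \int[leb m m]_Y (j%:R * a ^+ j.+1 * (`|\det Y| ^+ 0 * gauss_mx 1 Y))%:E.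
    by rewrite !Zm ?mulr_ge0 ?exprn_ge0// M0 mul1e mule1.
  rewrite -ge0_integralD//; last 2 first.
    by move=> Y _; rewrite lee_fin mul1r.
    by move=> Y _; rewrite lee_fin mulr_ge0// mulr_ge0// exprn_ge0.
  apply: ge0_le_integral => //.
  - by move=> Y _; rewrite lee_fin mulr_ge0// mulr_ge0// exprn_ge0.
  - by apply: emeasurable_funD.
  - move=> Y _; rewrite -EFinD lee_fin expr0 !mul1r mulrA expr1 -mulrDl.
    by rewrite ler_wpM2r ?gauss_mx_ge0// expr_tangent_le.
move=> H.
have {H} : (j.+1%:R * a ^+ j)%:E * a%:E <=
    gauss_det_moment R m j.+1 + (j%:R * a ^+ j.+1)%:E.
  apply: le_trans H; apply: lee_wpmul2l => //.
  by rewrite lee_fin mulr_ge0 ?exprn_ge0.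
rewrite -EFinM -mulrA -exprSr -leeBlDr//; apply: le_trans.
by rewrite -EFinB lee_fin -mulrBl -natrB// subSnn mul1r.
Qed.

End gauss_moment_lower_bound.

(** * Determinants of sign matrices *)

Section random_signs.
Context (R : realFieldType).

Definition sign_mx (m n : nat) (e : 'M[bool]_(m, n)) : 'M[R]_(m, n) :=
  map_mx (fun b : bool => (-1) ^+ b) e.

(** Averaging a quadratic form over independent signs adds its trace; choosing
    the better sign of each coordinate in turn does at least as well. *)
Lemma quadratic_signs (n : nat) (s : R) (Q : 'M[R]_n) (p : 'rV[R]_n) :
  exists e : 'rV[bool]_n,
    (p *m Q *m p^T) ord0 ord0 + s ^+ 2 * \tr Q <=
    ((p + s *: sign_mx e) *m Q *m (p + s *: sign_mx e)^T) ord0 ord0.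
Proof.
pose f (v : 'rV[R]_n) := (v *m Q *m v^T) ord0 ord0.
pose D (j : 'I_n) : 'rV[R]_n := delta_mx ord0 j.
have fD v j b : f (v + ((-1) ^+ b * s) *: D j) =
    f v + s ^+ 2 * Q j j + (-1) ^+ b * (s * (f (v + D j) - f v - f (D j))).
  have fQ t : f (v + t *: D j) =
      f v + t * ((v *m Q *m (D j)^T + D j *m Q *m v^T) ord0 ord0)
      + t ^+ 2 * f (D j).
    have -> : f (v + t *: D j) = ((v + t *: D j) *m Q *m
        (v^T + t *: (D j)^T)) ord0 ord0 by rewrite /f linearD linearZ.
    rewrite !mulmxDr !mulmxDl -!scalemxAr -!scalemxAl /f.
    have mxD (B C : 'M[R]_1) : (B + C) ord0 ord0 = B ord0 ord0 + C ord0 ord0.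
      by rewrite mxE.
    have mxZ c (B : 'M[R]_1) : (c *: B) ord0 ord0 = c * B ord0 ord0.
      by rewrite mxE.
    rewrite !(mxD, mxZ); ring.
  have fDj : f (D j) = Q j j.
    by rewrite /f /D -rowE trmx_delta -colE !mxE.
  have -> : f (v + D j) = f (v + 1 *: D j) by rewrite scale1r.
  rewrite !fQ fDj exprMn sqrr_sign; ring.
have step v j : exists b : bool, f v + s ^+ 2 * Q j j <=
    f (v + ((-1) ^+ b * s) *: D j).
  pose w := s * (f (v + D j) - f v - f (D j)).
  exists (w < 0); rewrite fD -/w lerDl.
  by case: ltP => [w0|w0]; rewrite ?expr1 ?expr0 ?mulN1r ?oppr_ge0 ?mul1r// ltW.
have [e eH] : exists e : 'I_n -> bool, f p + s ^+ 2 * \sum_(j <- index_enum 'I_n) Q j j <=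
    f (p + \sum_(j <- index_enum 'I_n) ((-1) ^+ e j * s) *: D j).
  elim: (index_enum 'I_n) (index_enum_uniq 'I_n) => [_|j js IH /= /andP[jjs ujs]].
    by exists xpred0; rewrite !big_nil mulr0 !addr0.
  have [e eH] := IH ujs.
  have [b bH] := step (p + \sum_(j <- js) ((-1) ^+ e j * s) *: D j) j.
  exists (fun i => if i == j then b else e i).
  rewrite !big_cons eqxx.
  have -> : \sum_(i <- js) ((-1) ^+ (if i == j then b else e i) * s) *: D i =
      \sum_(i <- js) ((-1) ^+ e i * s) *: D i.
    apply: eq_big_seq => i ijs; case: eqP => // ij.
    by move: jjs; rewrite -ij ijs.
  rewrite [X in p + X]addrC addrA; apply: le_trans bH.
  by rewrite mulrDr addrCA [leLHS]addrC lerD2r.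
exists (\row_j e j); apply: le_trans eH _.
rewrite le_eqVlt; apply/orP; left; apply/eqP; congr f.
rewrite [X in _ = _ + X]row_sum_delta; congr (_ + _); apply: eq_bigr => j _.
by rewrite !mxE mulrC.
Qed.

(** The Schur complement: adjoining a row [r] multiplies the Gram determinant
    by the squared distance from [r] to the span of the rows of [M]. *)
Lemma gram_col_mx (d m : nat) (M : 'M[R]_(d, m)) (r : 'rV[R]_m) :
  M *m M^T \in unitmx ->
  \det (col_mx r M *m (col_mx r M)^T) =
  \det (M *m M^T) *
  (r *m (1%:M - M^T *m invmx (M *m M^T) *m M) *m r^T) ord0 ord0.
Proof.
move=> uG; set G := M *m M^T in uG *.
rewrite tr_col_mx mul_col_row -/G.
have -> : block_mx (r *m r^T) (r *m M^T) (M *m r^T) G =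
    block_mx 1%:M (r *m M^T *m invmx G) 0 1%:M *m
    block_mx (r *m (1%:M - M^T *m invmx G *m M) *m r^T) 0 (M *m r^T) G.
  rewrite mulmx_block !(mul0mx, mul1mx, mulmx0, add0r) mulmxKV//.
  by rewrite mulmxBr mulmx1 mulmxBl !mulmxA subrK.
rewrite det_mulmx det_ublock det_lblock !det1 !mul1r det_mx11.
by rewrite mulrC.
Qed.

(** [P] is the orthogonal projection onto the complement of the row space of
    [M]. *)
Lemma gram_complement (d m : nat) (M : 'M[R]_(d, m)) (r : 'rV[R]_m)
    (P := 1%:M - M^T *m invmx (M *m M^T) *m M) :
  M *m M^T \in unitmx -> \tr P = m%:R - d%:R /\ 0 <= (r *m P *m r^T) ord0 ord0.
Proof.
set G := M *m M^T in P * => uG; split.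
  rewrite /P raddfB /= mxtrace1 -mulmxA mxtrace_mulC -mulmxA -/G.
  by rewrite mulVmx// mxtrace1.
have GT : G^T = G by rewrite /G trmx_mul trmxK.
have PT : P^T = P.
  rewrite /P raddfB /= trmx1 !trmx_mul trmxK trmx_inv GT mulmxA.
  by [].
have PP : P *m P = P.
  rewrite {1}/P mulmxBl mul1mx /P mulmxBr mulmx1.
  rewrite -[X in _ - (_ - X)]mulmxA [X in _ - (_ - _ *m X)]mulmxA.
  rewrite [X in _ - (_ - _ *m X)](_ : _ = M).
    by rewrite subrr subr0.
  by rewrite !mulmxA -/G mulmxV// mul1mx.
have -> : r *m P *m r^T = (r *m P) *m (r *m P)^T.
  by rewrite trmx_mul PT mulmxA -[r *m P *m P]mulmxA PP.
by rewrite mxE sumr_ge0// => i _; rewrite [X in _ * X]mxE -expr2 sqr_ge0.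
Qed.

(** Row by row: by [quadratic_signs] applied to the projection [P], the signs of
    a new row can be chosen so that its squared distance to the span of the [d]
    previous rows is at least [s^2 (m - d)]. *)
Lemma gram_signs (d m : nat) (s : R) (P : 'M[R]_(d, m)) : 0 < s -> (d <= m)%N ->
  exists e : 'M[bool]_(d, m),
    s ^+ (2 * d) * (m ^_ d)%:R <=
    \det ((P + s *: sign_mx e) *m (P + s *: sign_mx e)^T).
Proof.
move=> s0; elim: d P => [|d IHd] P dm.
  by exists 0; rewrite det_mx00 muln0 expr0 ffactn0 mul1r.
rewrite -[d.+1]/(1 + d)%N in P *.
have [e' e'H] := IHd (dsubmx P) (ltnW dm).
set M := dsubmx P + _ in e'H.
have G0 : 0 < \det (M *m M^T).
  apply: lt_le_trans e'H; rewrite mulr_gt0 ?exprn_gt0// ltr0n ffact_gt0.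
  exact: ltnW.
have uG : M *m M^T \in unitmx by rewrite unitmxE unitfE gt_eqF.
have [trP posP] := gram_complement (usubmx P) uG.
have [e0 e0H] := quadratic_signs s
  (1%:M - M^T *m invmx (M *m M^T) *m M) (usubmx P).
exists (col_mx e0 e').
have -> : P + s *: sign_mx (col_mx e0 e') =
    col_mx (usubmx P + s *: sign_mx e0) M.
  by rewrite /sign_mx map_col_mx scale_col_mx -{1}(vsubmxK P) add_col_mx.
rewrite gram_col_mx// add1n mulnS exprD ffactnSr natrM.
rewrite [s ^+ 2 * _]mulrC mulrACA.
apply: ler_pM => //.
- by rewrite mulr_ge0 ?exprn_ge0// ltW.
- by rewrite mulr_ge0 ?sqr_ge0.
apply: le_trans e0H; rewrite trP natrB ?(ltnW dm)//.
by rewrite -[leLHS]add0r lerD2r.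
Qed.

Lemma det_signs (m : nat) (s : R) (P : 'M[R]_m) : 0 < s ->
  exists e : 'M[bool]_m,
    s ^+ (2 * m) * (m`!)%:R <= \det (P + s *: sign_mx e) ^+ 2.
Proof.
move=> s0; have [e] := gram_signs P s0 (leqnn m).
by rewrite det_mulmx det_tr -expr2 ffactnn => eH; exists e.
Qed.

End random_signs.

(** * Determinant moments of a convex set *)

Section cube_det_moment.
Local Open Scope ereal_scope.
Context (R : realType).
Local Notation leb m n := (@lebesgue_mx R m n).

Definition mx_cube (c : R) (m : nat) : set 'M[R]_m :=
  mx_box (fun _ _ => `[0%R, c]%classic).

Arguments mx_cube : clear implicits.

Lemma measurable_mx_cube c m : measurable (mx_cube c m).
Proof. exact: measurable_mx_box. Qed.

Definition cube_det_bound (m k : nat) : R :=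
  (4^-1 ^+ (m * m) * (Num.sqrt m`!%:R * 4^-1 ^+ m) ^+ k)%R.

(** The cube is cut into [2^(m*m)] translates of a cube of half the side. For
    each position in the small cube, [det_signs] provides one translate where
    the determinant is large, so the sum over all translates is large
    everywhere; dividing by their number costs only [2^(m*m)]. *)
Lemma cube_det_moment (m k : nat) :
  (cube_det_bound m k)%:E <=
  \int[leb m m]_U (\1_(mx_cube 1 m) U * `|\det U| ^+ k)%:E.
Proof.
rewrite /cube_det_bound; set I := \int[_]_U _; set a := (Num.sqrt _ * _)%R.
have a0 : (0 <= a)%R by rewrite mulr_ge0 ?sqrtr_ge0 ?exprn_ge0 ?invr_ge0.
(* the entries of [W e] are 0 or 1/2 *)
pose W (e : 'M[bool]_m) : 'M[R]_m := (const_mx 4^-1 + 4^-1 *: sign_mx R e)%R.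
have W01 e i j : (0 <= W e i j <= 2^-1)%R.
  rewrite !mxE; case: (e i j); rewrite ?expr1 ?expr0; lra.
pose F c (U : 'M[R]_m) : \bar R := (\1_(mx_cube c m) U * `|\det U| ^+ k)%:E.
have mF c : measurable_fun setT (F c).
  apply/measurable_EFinP; apply: measurable_funM.
    by apply: measurable_indic; exact: measurable_mx_cube.
  exact: measurable_fun_normdetX.
have F0 c U : 0 <= F c U by rewrite lee_fin mulr_ge0 ?exprn_ge0.
have IW e : I = \int[leb m m]_T F 1%R (W e + T)%R.
  exact: (integral_addmx (W e) (mF 1%R) (F0 1%R)).
have half (T : 'M[R]_m) : (\1_(mx_cube 2^-1 m) T * a ^+ k)%:E <=
    \sum_(e : 'M[bool]_m) F 1%R (W e + T)%R.
  rewrite indicE; have [/set_mem Tc|_] := boolP (T \in mx_cube 2^-1 m); last first.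
    by rewrite mul0r sume_ge0.
  rewrite mul1r.
  have s4 : (0 < 4^-1 :> R)%R by rewrite invr_gt0.
  have [e eH] := det_signs (const_mx 4^-1 + T)%R s4.
  rewrite (bigD1 e)//=; apply: (@le_trans _ _ (F 1%R (W e + T)%R)); last first.
    by rewrite leeDl// sume_ge0.
  rewrite lee_fin indicE mem_set; last first.
    move=> i j; have := Tc i j; have := W01 e i j.
    rewrite /= !in_itv /= [in X in _ -> _ -> X]mxE.
    by move=> /andP[? ?] /andP[? ?]; apply/andP; split; lra.
  rewrite mul1r lerXn2r ?nnegrE//.
  rewrite -(@ler_pXn2r _ 2) ?nnegrE// exprMn sqr_sqrtr ?ler0n// real_normK ?num_real//.
  rewrite mulrC -exprM mulnC; apply: le_trans eH _.
  by rewrite /W addrAC.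
have : (2^-1 ^+ (m * m) * a ^+ k)%:E <= (2 ^+ (m * m))%:E * I.
  have -> : (2 ^+ (m * m))%:E * I =
      \int[leb m m]_T \sum_(e : 'M[bool]_m) F 1%R (W e + T)%R.
    rewrite ge0_integral_sum//; last first.
      by move=> e; apply: measurableT_comp => //; exact: measurable_fun_addmx.
    under eq_bigr do rewrite -IW.
    transitivity ((\sum_(e : 'M[bool]_m) 1%:E) * I).
      rewrite sumEFin sumr_const card_mx card_bool.
      by rewrite -natrX.
    rewrite ge0_sume_distrl//; first by apply: eq_bigr => e _; rewrite mul1e.
  have -> : (2^-1 ^+ (m * m) * a ^+ k)%:E =
      \int[leb m m]_T (\1_(mx_cube 2^-1 m) T * a ^+ k)%:E.
    under eq_integral do rewrite EFinM.
    rewrite ge0_integralZr//; last 2 first.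
      by apply/measurable_EFinP; apply: measurable_indic; exact: measurable_mx_cube.
      by rewrite lee_fin exprn_ge0.
    rewrite integral_indic ?setIT//; last exact: measurable_mx_cube.
    rewrite EFinM; congr (_ * _).
    apply/esym; apply: etrans (lebesgue_mx_box _) _ => //.
    under eq_bigr do under eq_bigr do
      rewrite lebesgue_measure_itv/= lte_fin invr_gt0 ltr0n /= oppr0 adde0.
    under eq_bigr do rewrite prodEFin.
    by rewrite prodEFin !prodr_const !card_ord -exprM.
  apply: ge0_le_integral => //.
  - by move=> T _; rewrite lee_fin mulr_ge0 ?exprn_ge0.
  - apply/measurable_EFinP; apply: measurable_funM => //.
    by apply: measurable_indic; exact: measurable_mx_cube.
  - apply: emeasurable_sum => e.
    by apply: measurableT_comp => //; exact: measurable_fun_addmx.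
move=> H.
rewrite -(@lee_pmul2l _ (2 ^+ (m * m))%:E)// ?lte_fin ?exprn_gt0//.
apply: le_trans H; rewrite -EFinM lee_fin mulrA -exprMn.
by rewrite (_ : 2 * 4^-1 = 2^-1 :> R)%R//; lra.
Qed.

End cube_det_moment.
Arguments mx_cube {R}.

Section simplex.
Context (R : realType).

Lemma convex_set_conv (n : nat) (C : set 'rV[R]_n) x y (t : R) :
  convex_set C -> 0 <= t <= 1 -> C x -> C y -> C (t *: x + (1 - t) *: y).
Proof.
move=> cC /andP[t0 t1] Cx Cy; apply: set_mem.
by apply: (cC x y (Itv01 t0 t1)); exact: mem_set.
Qed.

(** Subconvex combinations: the missing weight is put on the origin. *)
Lemma convex_set_subconvex (n m : nat) (C : set 'rV[R]_n) (v : 'I_m -> 'rV[R]_n)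
    (t : 'I_m -> R) :
  convex_set C -> C 0 -> (forall j, C (v j)) -> (forall j, 0 <= t j) ->
  \sum_j t j <= 1 -> C (\sum_j t j *: v j).
Proof.
move=> cC C0; elim: m v t => [|m IHm] v t Cv t0 t1.
  by rewrite big_ord0.
move: t1; rewrite !big_ord_recl; set s := \sum_(_ < _) _ => ts.
have s0 : 0 <= s by exact: sumr_ge0.
have := t0 ord0; rewrite le_eqVlt => /predU1P[<-|t00].
  by rewrite scale0r add0r; apply: IHm => //; rewrite -/s; have := t0 ord0; lra.
have [t01|t01] := leP 1 (t ord0).
  have s00 : s = 0 by lra.
  have -> : \sum_(i < m) t (lift ord0 i) *: v (lift ord0 i) = 0.
    apply: big1 => i _.
    have : t (lift ord0 i) = 0.
      apply/eqP; rewrite eq_le t0 andbT -s00 /s (bigD1 i)//= lerDl.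
      exact: sumr_ge0.
    by move=> ->; rewrite scale0r.
  have -> : t ord0 = 1 by lra.
  by rewrite scale1r addr0.
have u0 : 0 < 1 - t ord0 by rewrite subr_gt0.
have -> : \sum_(i < m) t (lift ord0 i) *: v (lift ord0 i) =
    (1 - t ord0) *: \sum_(i < m) (t (lift ord0 i) / (1 - t ord0)) *: v (lift ord0 i).
  rewrite scaler_sumr; apply: eq_bigr => i _.
  by rewrite scalerA mulrC divfK// gt_eqF.
apply: convex_set_conv => //; first by rewrite !ltW.
apply: IHm => //.
  by move=> j; rewrite divr_ge0// ltW.
by rewrite -mulr_suml ler_pdivrMr// mul1r -/s; lra.
Qed.

Definition rows_in (m n : nat) (C : set 'rV[R]_n) : set 'M[R]_(m, n) :=
  [set Y | forall i, C (row i Y)].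

Lemma measurable_rows_in (m n : nat) (C : set 'rV[R]_n) :
  measurable C -> measurable (@rows_in m n C).
Proof.
move=> mC; rewrite (_ : rows_in _ = \bigcap_(i in [set: 'I_m])
    (setT `&` (fun Y : 'M[R]_(m, n) => row i Y) @^-1` C)).
  apply: fin_bigcap_measurable => // i _.
  have mrow : measurable_fun setT (fun Y : 'M[R]_(m, n) => row i Y).
    exact: measurable_fun_row.
  exact: mrow.
apply/seteqP; split=> Y /=; first by move=> CY i _; split.
by move=> CY i; have [] := CY i I.
Qed.

Lemma rows_in_mul (m n p : nat) (C : set 'rV[R]_n) (U : 'M[R]_(p, m))
    (Y : 'M[R]_(m, n)) :
  convex_set C -> C 0 -> rows_in C Y -> (forall i j, 0 <= U i j) ->
  (forall i, \sum_j U i j <= 1) -> rows_in C (U *m Y).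
Proof.
move=> cC C0 CY U0 U1 i; rewrite row_mul mulmx_sum_row.
under eq_bigr do rewrite mxE.
exact: convex_set_subconvex.
Qed.

(** Matrices with entries in [[0, 1/m]] have rows in the standard simplex, so
    they send [Y0] into the tuples of points of [C]: the bound is the moment of
    this cube, transported by [Y0]. *)
Lemma simplex_det_moment (m k : nat) (C : set 'rV[R]_m) (Y0 : 'M[R]_m) :
  (0 < m)%N -> measurable C -> convex_set C -> C 0 -> rows_in C Y0 ->
  (((m%:R^-1 ^+ m * `|\det Y0|) ^+ (m + k) * cube_det_bound R m k)%:E <=
   \int[@lebesgue_mx R m m]_Y (\1_(rows_in C) Y * `|\det Y| ^+ k)%:E)%E.
Proof.
move=> m0 mC cC C0 CY0.
have [Y00|Y00] := eqVneq (\det Y0) 0.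
  rewrite Y00 normr0 mulr0 expr0n addn_eq0 -leqn0 leqNgt m0 mul0r.
  by apply: integral_ge0 => Y _; rewrite lee_fin mulr_ge0 ?exprn_ge0.
pose T : 'M[R]_m := m%:R^-1 *: Y0.
have mR : 0 < m%:R^-1 :> R by rewrite invr_gt0 ltr0n.
have dT : `|\det T| = m%:R^-1 ^+ m * `|\det Y0|.
  by rewrite /T detZ normrM ger0_norm// exprn_ge0// ltW.
have uT : T \in unitmx.
  by rewrite unitmxE unitfE -normr_eq0 dT mulf_neq0 ?normr_eq0// expf_neq0// gt_eqF.
have mf (D : set 'M[R]_m) : measurable D ->
    measurable_fun setT (fun Y : 'M[R]_m => (\1_D Y * `|\det Y| ^+ k)%:E).
  move=> mD; apply/measurable_EFinP; apply: measurable_funM.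
    exact: measurable_indic.
  exact: measurable_fun_normdetX.
have f0 (D : set 'M[R]_m) (Y : 'M[R]_m) : (0 <= (\1_D Y * `|\det Y| ^+ k)%:E)%E.
  by rewrite lee_fin mulr_ge0 ?exprn_ge0.
rewrite (integral_mulmxr uT) //; last exact: (mf _ (measurable_rows_in mC)).
rewrite -dT exprD -mulrA EFinM; apply: lee_wpmul2l.
  by rewrite lee_fin exprn_ge0.
rewrite EFinM.
apply: (@le_trans _ _ ((`|\det T| ^+ k)%:E * \int[@lebesgue_mx R m m]_U
    (\1_(mx_cube 1 m) U * `|\det U| ^+ k)%:E)%E).
  by apply: lee_wpmul2l; [rewrite lee_fin exprn_ge0|exact: cube_det_moment].
rewrite -ge0_integralZl//; last first.
  exact: (mf (mx_cube 1 m) (@measurable_mx_cube R 1 m)).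
apply: ge0_le_integral => //.
- by apply: emeasurable_funM => //; exact: (mf (mx_cube 1 m) (@measurable_mx_cube R 1 m)).
- apply: (measurableT_comp (mf _ (measurable_rows_in mC))).
  exact: measurable_fun_mulmx.
move=> U _; rewrite -EFinM lee_fin det_mulmx normrM exprMn.
rewrite mulrCA [`|\det T| ^+ k * _]mulrC ler_wpM2r ?mulr_ge0 ?exprn_ge0//.
rewrite !indicE; have [/set_mem Uc|//] := boolP (U \in mx_cube 1 m).
rewrite mem_set// /T -scalemxAr scalemxAl; apply: rows_in_mul => //.
  move=> i j; rewrite mxE mulr_ge0 ?(ltW mR)//.
  by have := Uc i j; rewrite /= in_itv /= => /andP[].
move=> i; apply: (@le_trans _ _ (\sum_(j < m) m%:R^-1)).
  apply: ler_sum => j _; rewrite mxE ler_piMr ?(ltW mR)//.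
  by have := Uc i j; rewrite /= in_itv /= => /andP[].
by rewrite sumr_const card_ord -(mulr_natl m%:R^-1 m) divff// pnatr_eq0 -lt0n.
Qed.

End simplex.

(** * Fibres over graphs *)

Section fibers.
Local Open Scope ereal_scope.
Context (R : realType).
Local Notation leb m n := (@lebesgue_mx R m n).

Lemma compact_entry_bound (n : nat) (K : set 'rV[R]_n) : compact K ->
  exists r : R, forall x, K x -> forall i j, (- r <= x i j <= r)%R.
Proof.
move=> /compact_bounded[M [_ HM]]; exists (M + 1 + 1)%R => x Kx i j.
have xM : (`|x| <= M + 1)%R by apply: HM => //; rewrite ltrDl.
have : ball (0%R : 'rV[R]_n) (M + 1 + 1)%R x.
  by rewrite mx_norm_ball /ball_/= sub0r normrN (le_lt_trans xM)// ltrDl.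
move=> [_ /(_ i j)]; rewrite mxE /ball/= sub0r normrN => /ltW.
by rewrite ler_norml.
Qed.

Lemma compact_measurable_mx (m n : nat) (K : set 'M[R]_(m, n)) :
  compact K -> measurable K.
Proof.
move=> cK; rewrite -[K]setCK; apply: measurableC.
apply: open_measurable_mx; rewrite openC; apply: compact_closed cK.
exact: norm_hausdorff.
Qed.

Lemma lebesgue_mx_bounded (m n : nat) (D : set 'M[R]_(m, n)) (r : R) :
  measurable D -> (forall X, D X -> forall i j, (- r <= X i j <= r)%R) ->
  leb m n D < +oo.
Proof.
move=> mD Dr.
apply: (@le_lt_trans _ _ (leb m n (mx_box (fun _ _ => `[(- r)%R, r]%classic)))).
  have DB : D `<=` mx_box (fun _ _ => `[(- r)%R, r]%classic).
    by move=> X /Dr XD i j; rewrite /= in_itv/= XD.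
  apply: le_measure => //; rewrite inE//; exact: measurable_mx_box.
rewrite lebesgue_mx_box// ltey_eq; apply/orP; left.
apply: prode_fin_num => i _; apply: prode_fin_num => j _.
by rewrite lebesgue_measure_itv/=; case: ifP.
Qed.

Definition graph_fiber (m k : nat) (A : 'M[R]_(m, k)) (C : set 'rV[R]_(m + k)) :
  set 'rV[R]_m := [set y | C (y *m row_mx 1%:M A)%R].

Lemma measurable_graph_fiber (m k : nat) (A : 'M[R]_(m, k)) C :
  measurable C -> measurable (graph_fiber A C).
Proof.
move=> mC; rewrite -[X in measurable X]setTI.
have mG : measurable_fun setT (fun y : 'rV[R]_m => y *m row_mx 1%:M A)%R.
  exact: measurable_fun_mulmx.
exact: mG.
Qed.

Lemma convex_graph_fiber (m k : nat) (A : 'M[R]_(m, k)) C :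
  convex_set C -> convex_set (graph_fiber A C).
Proof.
move=> cC x y l /set_mem Cx /set_mem Cy; apply: mem_set.
have := cC _ _ l (mem_set Cx) (mem_set Cy) => /set_mem.
rewrite /graph_fiber /=; congr C.
by rewrite /conv /= mulmxDl -!scalemxAl.
Qed.

Lemma graph_fiber_bound (m k : nat) (A : 'M[R]_(m, k))
    (C : set 'rV[R]_(m + k)) (r : R) :
  (forall x, C x -> forall i j, (- r <= x i j <= r)%R) ->
  forall y, graph_fiber A C y -> forall i j, (- r <= y i j <= r)%R.
Proof.
move=> Cr y /Cr yr i j; have := yr i (lshift k j).
by rewrite mul_mx_row mulmx1 row_mxEl.
Qed.

Variables (m k : nat) (f : 'rV[R]_(m + k) -> R).
Hypothesis mf : measurable_fun [set: 'rV[R]_(m + k)] f.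
Hypothesis f0 : (forall x, 0 <= f x)%R.

Definition restricted (C : set 'rV[R]_(m + k)) (x : 'rV[R]_(m + k)) : R :=
  (\1_C x * f x)%R.

Lemma restricted_ge0 C x : (0 <= restricted C x)%R.
Proof. by rewrite mulr_ge0. Qed.

Lemma measurable_restricted C : measurable C -> measurable_fun setT (restricted C).
Proof. by move=> mC; apply: measurable_funM. Qed.

Lemma integral_restricted (mu : {measure set 'rV[R]_(m + k) -> \bar R}) C :
  \int[mu]_(x in C) (f x)%:E = \int[mu]_x (restricted C x)%:E.
Proof.
rewrite integral_mkcond; apply: eq_integral => x _.
by rewrite patchE /restricted indicE; case: ifP; rewrite ?mul1r ?mul0r.
Qed.

Definition fiber_integral (A : 'M[R]_(m, k)) (C : set 'rV[R]_(m + k)) :=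
  \int[leb 1 m]_y (restricted C (y *m row_mx 1%:M A)%R)%:E.

Lemma measurable_graph_space (A : 'M[R]_(m, k)) :
  measurable [set` graph_space A].
Proof.
have mg : measurable_fun setT
    (fun x : 'rV[R]_(m + k) => x - lsubmx x *m row_mx 1%:M A)%R.
  apply: measurable_fun_addmx => //.
  apply: measurable_fun_mxP => i j; under eq_fun do rewrite 2!mxE.
  apply: (measurableT_comp (@oppr_measurable R setT)).
  apply: measurable_sum => l; apply: measurable_funM => //.
  under eq_fun do rewrite mxE.
  exact: measurable_coord.
have := mg measurableT _ (@measurable_mx_box R 1 (m + k) (fun _ _ => [set 0%R])
  (fun _ _ => measurable_set1 _)).
rewrite setTI; congr measurable; apply/seteqP; split=> x /=.
  move=> x0; rewrite mem_graph_space -subr_eq0; apply/eqP/matrixP => i j.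
  by rewrite x0 mxE.
rewrite mem_graph_space -subr_eq0 => /eqP x0 i j.
by rewrite x0 mxE.
Qed.

(** The orthonormal coordinates of the graph and the first [m] coordinates
    differ by the matrix [T] of [orthonormal_graph_basis]. *)
Lemma fiber_integralE (A : 'M[R]_(m, k)) (C : set 'rV[R]_(m + k)) :
  measurable C ->
  fiber_integral A C = (graph_factor A)%:E *
    section_measure f (graph_space A) C.
Proof.
move=> mC.
have [BE TE] := @orthonormal_graph_basis R m k A _ erefl.
have -> : section_measure f (graph_space A) C =
    \int[lebesgue_rV R (\dim (graph_space A))]_y
      (restricted C (y *m orthonormal_basis (graph_space A))%R)%:E.
  rewrite /section_measure integral_mkcond.
  have mB : measurable_fun setT (mulmxr (orthonormal_basis (graph_space A)) :
      'rV[R]_(\dim (graph_space A)) -> 'rV[R]_(m + k)).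
    exact: measurable_mulmxr.
  rewrite /lebesgue_on.
  rewrite ge0_integral_pushforward//.
  - apply: eq_integral => y _ /=.
    rewrite patchE /restricted indicE.
    have -> : (y *m orthonormal_basis (graph_space A) \in C `&` [set` graph_space A]) =
        (y *m orthonormal_basis (graph_space A) \in C).
      apply/idP/idP => [/set_mem[? _]|/set_mem ?]; first exact: mem_set.
      apply: mem_set; split => //=.
      rewrite BE mulmxA mem_graph_space mul_mx_row row_mxKl mulmx1.
      by rewrite mul_mx_row mulmx1.
    by case: ifP; rewrite ?mul1r ?mul0r.
  - apply/(measurable_restrictT _ _).1.
      by apply: measurableI => //; exact: measurable_graph_space.
    by apply: measurable_funTS; apply/measurable_EFinP.
  - by move=> y _; rewrite patchE; case: ifP => // _; rewrite lee_fin.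
move: (orthonormal_basis _) BE TE => B; move: (lsubmx B) => T BE TE.
rewrite {}BE; move: T TE; rewrite dim_graph_space => T TE.
have uT : T \in unitmx.
  by have /mulmx1_unit[] : (T *m (graph_gram A *m T^T) = 1%:M)%R
    by rewrite mulmxA.
have mres (G : 'M[R]_(m, m + k)) :
    measurable_fun setT (fun y : 'rV[R]_m => (restricted C (y *m G)%R)%:E).
  apply/measurable_EFinP.
  apply: (measurableT_comp (measurable_restricted mC)).
  exact: measurable_fun_mulmx.
rewrite /fiber_integral (integral_mulmxr uT)//; last first.
  by move=> y; rewrite lee_fin restricted_ge0.
rewrite expr1 (graph_factorE TE); congr (_ * _).
rewrite -integral_lebesgue_rV//; last first.
  by move=> y; rewrite lee_fin restricted_ge0.
by apply: eq_integral => y _; rewrite mulmxA.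
Qed.

End fibers.

(** * The numerical balance *)

(** The falling factorial [(2m)!/m!] is at least [m^m], and it is [m!] times a
    central binomial coefficient. *)
Lemma expn_self_le (m : nat) : (m ^ m <= 4 ^ m * m`!)%N.
Proof.
have mf : (m ^ m <= (m + m) ^_ m)%N.
  rewrite ffact_prod -[X in (_ ^ X <= _)%N]card_ord -prod_nat_const.
  by apply: leq_prod => i _; rewrite -addnBA ?leq_addr// ltnW.
apply: (leq_trans mf); rewrite -bin_ffact leq_mul2r; apply/orP; right.
rewrite (_ : 4 ^ m = (1 + 1) ^ (m + m))%N; last first.
  by rewrite expnD -expnMn.
rewrite expnDn (bigD1 (inord m : 'I_(m + m).+1))//= inordK ?ltnS ?leq_addr//.
by rewrite !exp1n !muln1 leq_addr.
Qed.

Section numeric_bound.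
Context (R : realType).

Definition gauss_const : R := expR (- (4 * pi)) / 2.

Lemma gauss_const_gt0 : 0 < gauss_const.
Proof. by rewrite divr_gt0 ?expR_gt0. Qed.

Lemma gauss_const_le : gauss_const <= 2^-1.
Proof.
rewrite /gauss_const ler_pdivrMr// mulVf// -[leRHS]expR0 ler_expR.
by rewrite oppr_le0 mulr_ge0 ?pi_ge0.
Qed.

Lemma gauss_const_sqrt_fact (m : nat) :
  (gauss_const * Num.sqrt m%:R) ^+ m <= Num.sqrt (m`!)%:R.
Proof.
have b0 := ltW gauss_const_gt0.
rewrite -(@ler_pXn2r _ 2) ?nnegrE ?sqrtr_ge0 ?exprn_ge0 ?mulr_ge0 ?sqrtr_ge0//.
rewrite sqr_sqrtr ?ler0n// -exprM mulnC exprM [(gauss_const * _) ^+ 2]exprMn sqr_sqrtr ?ler0n//.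
apply: (@le_trans _ _ ((4^-1 * m%:R) ^+ m)).
  rewrite lerXn2r ?nnegrE ?mulr_ge0 ?sqr_ge0//.
  apply: ler_wpM2r => //; rewrite (_ : 4^-1 = 2^-1 ^+ 2); last by lra.
  by rewrite lerXn2r ?nnegrE// gauss_const_le.
rewrite exprMn exprVn ler_pdivrMl ?exprn_gt0//.
by rewrite -!natrX -natrM ler_nat expn_self_le.
Qed.

Lemma powR_root (a : R) (n : nat) : 0 < a -> (0 < n)%N ->
  0 < a `^ n%:R^-1 /\ (a `^ n%:R^-1) ^+ n = a.
Proof.
move=> a0 n0; split; first exact: powR_gt0.
rewrite -powR_mulrn ?powR_ge0// -powRrM mulVf ?powRr1 ?ltW//.
by rewrite pnatr_eq0 -lt0n.
Qed.

(** Weighted AM-GM for [r1 * x] and [r2 * t]: the scalings make [r1^k * r2^m]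
    the inverse of the leading constant, while their powers of exponent [m + k]
    stay below the coefficients of the two terms. *)
Lemma det_AGM (m k : nat) (x t V : R) : (0 < m)%N -> (0 < k)%N ->
  0 <= x -> 0 <= t -> 0 < V ->
  x ^+ k * t ^+ m <=
  (4 / gauss_const * Num.sqrt m%:R) ^+ (k * m) *
  V `^ ((k * m)%:R / (m + k)%:R) *
  (k%:R / (m + k)%:R / V ^+ m *
     ((m%:R^-1 ^+ m * x) ^+ (m + k) * cube_det_bound R m k) +
   m%:R / (m + k)%:R * (t ^+ (m + k) *
     (gauss_const * Num.sqrt m%:R) ^+ (m * k))).
Proof.
move=> m0 k0 x0 t0 V0; set n := (m + k)%N.
have n0 : (0 < n)%N by rewrite addn_gt0 m0.
have b0 := gauss_const_gt0; set b := gauss_const in b0 *.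
have mR : 0 < m%:R :> R by rewrite ltr0n.
have sm0 : 0 < Num.sqrt (m%:R : R) by rewrite sqrtr_gt0.
have smm : Num.sqrt (m%:R : R) * Num.sqrt m%:R = m%:R.
  by rewrite -expr2 sqr_sqrtr// ltW.
have [] := powR_root (mulr_gt0 b0 sm0) n0; set w := _ `^ _ => w0 wn.
have [] := powR_root V0 n0; set v := _ `^ _ => v0 vn.
(* [w] and [v] are the roots of order [m + k] of [b * sqrt m] and of [V] *)
pose r1 := (4 * m%:R)^-1 ^+ m * w ^+ (m * k) / v ^+ m.
pose r2 := w ^+ (m * k).
have r10 : 0 < r1.
  by rewrite divr_gt0 ?mulr_gt0 ?exprn_gt0// invr_gt0 mulr_gt0.
have r20 : 0 < r2 by rewrite exprn_gt0.
have VE : V `^ ((k * m)%:R / n%:R) = v ^+ (k * m).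
  by rewrite mulrC powRrM powR_mulrn// powR_ge0.
have r12 : r1 ^+ k * r2 ^+ m * ((4 / b * Num.sqrt m%:R) ^+ (k * m) *
    V `^ ((k * m)%:R / n%:R)) = 1.
  have -> : r1 ^+ k * r2 ^+ m =
      ((4 * m%:R)^-1 * (b * Num.sqrt m%:R) / v) ^+ (k * m).
    rewrite -wn [RHS]exprMn [in RHS]exprMn -[w ^+ n ^+ _]exprM.
    rewrite (_ : w ^+ (n * (k * m)) = w ^+ (m * k * k) * w ^+ (m * k * m));
      last by rewrite -exprD; congr (w ^+ _); rewrite /n; lia.
    have -> : r1 ^+ k =
        (4 * m%:R)^-1 ^+ (m * k) * w ^+ (m * k * k) * v^-1 ^+ (m * k).
      by rewrite /r1 -exprVn !exprMn -!exprM.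
    have -> : r2 ^+ m = w ^+ (m * k * m) by rewrite /r2 -exprM.
    by rewrite (mulnC k m); ring.
  rewrite VE -!exprMn (_ : _ * _ = 1) ?expr1n//.
  move: (Num.sqrt _) sm0 smm => q q0 <-.
  by field; rewrite !gt_eqF.
have AGM := weighted_AGM (mulr_ge0 (ltW r10) x0) (mulr_ge0 (ltW r20) t0) n0.
have H1 : (r1 * x) ^+ n <= V ^- m *
    ((m%:R^-1 ^+ m * x) ^+ n * cube_det_bound R m k).
  have -> : (m%:R^-1 ^+ m * x) ^+ n * cube_det_bound R m k =
      ((4 * m%:R)^-1 ^+ m * x) ^+ n * Num.sqrt (m`!)%:R ^+ k.
    rewrite /cube_det_bound invfM !exprMn.
    have -> : (4^-1 ^+ m) ^+ n = 4^-1 ^+ (m * m) * (4^-1 ^+ m) ^+ k :> R.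
      by rewrite /n exprD -exprM.
    ring.
  have -> : (r1 * x) ^+ n = V ^- m * (((4 * m%:R)^-1 ^+ m * x) ^+ n *
      ((b * Num.sqrt m%:R) ^+ m) ^+ k).
    have -> : V ^- m = (v ^- m) ^+ n.
      by rewrite -[V in V ^- m]vn -exprM mulnC exprM exprVn.
    have -> : ((b * Num.sqrt m%:R) ^+ m) ^+ k = (w ^+ (m * k)) ^+ n.
      by rewrite -wn -!exprM; congr (w ^+ _); lia.
    by rewrite /r1 -!exprMn; congr (_ ^+ n); ring.
  apply: ler_wpM2l; first by rewrite invr_ge0 exprn_ge0// ltW.
  apply: ler_wpM2l.
    by rewrite exprn_ge0// mulr_ge0// exprn_ge0// invr_ge0 mulr_ge0// ltW.
  apply: lerXn2r; last exact: gauss_const_sqrt_fact.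
    by rewrite nnegrE exprn_ge0// mulr_ge0 ?sqrtr_ge0// ltW.
  by rewrite nnegrE sqrtr_ge0.
have H2 : (r2 * t) ^+ n = t ^+ n * (b * Num.sqrt m%:R) ^+ (m * k).
  by rewrite exprMn mulrC /r2 -exprM mulnC exprM wn.
have nR : 0 < n%:R :> R by rewrite ltr0n.
set Q := (4 / b * _) ^+ _ * _ in r12 *.
have rr0 : 0 < r1 ^+ k * r2 ^+ m by rewrite mulr_gt0 ?exprn_gt0.
rewrite -(ler_pM2l rr0) [leRHS]mulrA r12 mul1r.
rewrite -(ler_pM2l nR).
rewrite [leLHS](_ : _ = n%:R * ((r1 * x) ^+ k * (r2 * t) ^+ m)); last first.
  by rewrite !exprMn; ring.
apply: (le_trans AGM).
rewrite [leRHS](_ : _ = k%:R * (V ^- m *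
    ((m%:R^-1 ^+ m * x) ^+ n * cube_det_bound R m k)) +
    m%:R * (t ^+ n * (b * Num.sqrt m%:R) ^+ (m * k))); last first.
  rewrite mulrDr; congr (_ + _).
    move: (_ * cube_det_bound _ _ _) => Z.
    have: V ^+ m != 0 by rewrite expf_neq0// gt_eqF.
    have: n%:R != 0 :> R by rewrite gt_eqF.
    move: (n%:R : R) (V ^+ m) => N W N0 W0.
    by field; rewrite N0 W0.
  rewrite [LHS]mulrA; congr (_ * _).
  by rewrite mulrC divfK// gt_eqF.
by rewrite lerD// ?H2// ler_wpM2l.
Qed.

End numeric_bound.

(** * The fibrewise bound *)

Section fiberwise.
Local Open Scope ereal_scope.
Context (R : realType) (m k : nat).
Local Notation leb m n := (@lebesgue_mx R m n).
Variables (K : set 'rV[R]_(m + k)).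
Hypothesis mK : measurable K.

(** The density in [A], given by [blaschke_petkantschin], of the volume of the
    [m]-tuples of points of [K]. *)
Definition fiber_det_moment (A : 'M[R]_(m, k)) : \bar R :=
  \int[leb m m]_Y (\1_(rows_in (graph_fiber A K)) Y * `|\det Y| ^+ k)%:E.

(** A convex combination of two probability densities in [A]: the share of [A] in
    the tuples of [K], and its share in Gaussian tuples. *)
Definition fiber_weight (V : R) (A : 'M[R]_(m, k)) : \bar R :=
  (k%:R / (m + k)%:R / V ^+ m)%:E * fiber_det_moment A +
  (m%:R / (m + k)%:R)%:E *
    ((graph_factor A ^+ (m + k))%:E * gauss_det_moment R m k).

Lemma fiber_det_moment_ge0 A : 0 <= fiber_det_moment A.
Proof.
by apply: integral_ge0 => Y _; rewrite lee_fin mulr_ge0 ?exprn_ge0.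
Qed.

Lemma indic_rows_in_mul (A : 'M[R]_(m, k)) (Y : 'M[R]_m) :
  \1_(rows_in (graph_fiber A K)) Y = \1_(rows_in K) (row_mx Y (Y *m A)) :> R.
Proof.
rewrite !indicE; congr (_%:R); congr nat_of_bool; apply/idP/idP.
  move=> /set_mem KY; apply: mem_set => i; have := KY i.
  by rewrite /graph_fiber /= -row_mul mul_mx_row mulmx1.
move=> /set_mem KY; apply: mem_set => i; have := KY i.
by rewrite /graph_fiber /= -row_mul mul_mx_row mulmx1.
Qed.

Lemma fiber_det_momentE A : fiber_det_moment A =
  \int[leb m m]_Y ((`|\det Y| ^+ k)%:E *
    (\1_(rows_in K) (row_mx Y (Y *m A)%R))%:E).
Proof.
by apply: eq_integral => Y _; rewrite indic_rows_in_mul mulrC EFinM.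
Qed.

Lemma measurable_fiber_det_moment : measurable_fun setT fiber_det_moment.
Proof.
rewrite (_ : fiber_det_moment = fun A => \int[leb m m]_Y ((`|\det Y| ^+ k)%:E *
    (\1_(rows_in K) (row_mx Y (Y *m A)%R))%:E)); last first.
  by apply/funext => A; rewrite fiber_det_momentE.
apply: (@measurable_fun_fubini_tonelli_F _ _ _ _ R (leb m m)
  (fun p : 'M[R]_(m, k) * 'M[R]_m => (`|\det p.2| ^+ k)%:E *
    (\1_(rows_in K) (row_mx p.2 (p.2 *m p.1)%R))%:E)) => //.
apply: emeasurable_funM; apply/measurable_EFinP.
  exact: measurable_fun_normdetX.
apply: measurableT_comp.
  by apply: measurable_indic; exact: measurable_rows_in.
by apply: measurable_fun_row_mx => //; exact: measurable_fun_mulmx.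
Qed.

Lemma prod_indic (n : nat) (C : set 'rV[R]_n) (X : 'M[R]_(m, n)) :
  (\prod_(i < m) \1_C (row i X))%R = \1_(rows_in C) X :> R.
Proof.
rewrite [RHS]indicE; have [/set_mem CX|nCX] := boolP (X \in rows_in C).
  by apply: big1 => i _; rewrite indicE mem_set//; exact: CX.
have [i nCi] : exists i, ~ C (row i X).
  by apply/existsNP => CX; move/negP: nCX; apply; apply: mem_set.
by rewrite (bigD1 i)//= indicE memNset// mul0r.
Qed.

Lemma integral_fiber_det_moment (V : R) : leb 1 (m + k) K = V%:E ->
  \int[leb m k]_A fiber_det_moment A = (V ^+ m)%:E.
Proof.
move=> KV.
under eq_integral do rewrite fiber_det_momentE.
have mI : measurable_fun setT (fun X : 'M[R]_(m, m + k) => (\1_(rows_in K) X)%:E : \bar R).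
  by apply/measurable_EFinP; apply: measurable_indic; exact: measurable_rows_in.
rewrite -(@blaschke_petkantschin R m k (fun X => (\1_(rows_in K) X)%:E)) //.
under eq_integral do rewrite -prod_indic.
rewrite integral_prod_rows// EFin_expe; congr (_ ^+ m).
by rewrite integral_indic// setIT; exact: KV.
Qed.

Lemma fiber_weight_ge0 (V : R) A : (0 < V)%R -> 0 <= fiber_weight V A.
Proof.
move=> V0; rewrite /fiber_weight; apply: adde_ge0; apply: mule_ge0.
- by rewrite lee_fin !divr_ge0// exprn_ge0// ltW.
- exact: fiber_det_moment_ge0.
- by rewrite lee_fin divr_ge0.
- apply: mule_ge0; last exact: gauss_det_moment_ge0.
  by rewrite lee_fin exprn_ge0// ltW// graph_factor_gt0.
Qed.

Lemma measurable_fiber_weight (V : R) : measurable_fun setT (fiber_weight V).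
Proof.
apply: emeasurable_funD; apply: emeasurable_funM => //.
  exact: measurable_fiber_det_moment.
exact: gauss_fiber_measurable.
Qed.

Lemma integral_fiber_weight (V : R) : (0 < m + k)%N -> (0 < V)%R ->
  leb 1 (m + k) K = V%:E -> \int[leb m k]_A fiber_weight V A = 1.
Proof.
move=> mk0 V0 KV.
have c1 : 0 <= (k%:R / (m + k)%:R / V ^+ m)%:E.
  by rewrite lee_fin !divr_ge0// exprn_ge0// ltW.
have c2 : 0 <= (m%:R / (m + k)%:R)%:E :> \bar R by rewrite lee_fin divr_ge0.
have I0 := fiber_det_moment_ge0; have mI := measurable_fiber_det_moment.
have G0 (A : 'M[R]_(m, k)) :
    0 <= (graph_factor A ^+ (m + k))%:E * gauss_det_moment R m k.
  apply: mule_ge0; last exact: gauss_det_moment_ge0.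
  by rewrite lee_fin exprn_ge0// ltW// graph_factor_gt0.
have mG := @gauss_fiber_measurable R m k.
rewrite ge0_integralD; first last.
- by apply: emeasurable_funM.
- by move=> A _; apply: mule_ge0.
- by apply: emeasurable_funM.
- by move=> A _; apply: mule_ge0.
- exact: measurableT.
rewrite !ge0_integralZl//.
rewrite (integral_fiber_det_moment KV) integral_graph_factor mule1 -EFinM -EFinD.
rewrite divfK ?gt_eqF ?exprn_gt0// -mulrDl -natrD addnC divff//.
by rewrite pnatr_eq0 -lt0n.
Qed.

(** [det_AGM], with its two terms bounded by the moments of [simplex_det_moment]
    and [gauss_det_moment_ge]. *)
Lemma det_fiber_weight (V : R) (A : 'M[R]_(m, k)) (Y : 'M[R]_m) :
  (0 < m)%N -> (0 < k)%N -> (0 < V)%R -> convex_set K -> K 0%R ->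
  rows_in (graph_fiber A K) Y ->
  (`|\det Y| ^+ k * graph_factor A ^+ m)%:E <=
  ((4 / gauss_const R * Num.sqrt m%:R) ^+ (k * m) *
    V `^ ((k * m)%:R / (m + k)%:R))%:E * fiber_weight V A.
Proof.
move=> m0 k0 V0 cK K0 KY.
have t0 := ltW (graph_factor_gt0 A).
have := det_AGM m0 k0 (normr_ge0 (\det Y)) t0 V0.
set B := (_ * V `^ _)%R.
have B0 : (0 <= B)%R.
  rewrite mulr_ge0 ?powR_ge0// exprn_ge0// mulr_ge0 ?sqrtr_ge0//.
  by rewrite divr_ge0// ltW// gauss_const_gt0.
rewrite -lee_fin => H; apply: (le_trans H); rewrite EFinM; apply: lee_wpmul2l => //.
rewrite EFinD /fiber_weight [in X in X <= _]EFinM [X in _ + X <= _]EFinM.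
apply: leeD; apply: lee_wpmul2l.
- by rewrite lee_fin !divr_ge0// exprn_ge0// ltW.
- apply: simplex_det_moment => //.
  + exact: measurable_graph_fiber.
  + exact: convex_graph_fiber.
  + by rewrite /graph_fiber /= mul0mx.
- by rewrite lee_fin divr_ge0.
rewrite EFinM; apply: lee_wpmul2l; first by rewrite lee_fin exprn_ge0.
exact: gauss_det_moment_ge.
Qed.

End fiberwise.

Section main_inequality.
Local Open Scope ereal_scope.
Context (R : realType) (m k : nat).
Local Notation leb m n := (@lebesgue_mx R m n).
Variables (K L : set 'rV[R]_(m + k)) (f : 'rV[R]_(m + k) -> R) (M : R).
Hypothesis m0 : (0 < m)%N.
Hypothesis k0 : (0 < k)%N.
Hypothesis cK : compact K.
Hypothesis convK : convex_set K.
Hypothesis K0 : K 0%R.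
Hypothesis mL : measurable L.
Hypothesis LK : L `<=` K.
Hypothesis mf : measurable_fun [set: 'rV[R]_(m + k)] f.
Hypothesis f0 : forall x, (0 <= f x)%R.
Hypothesis fM : forall x, (f x <= M)%R.

Let mK : measurable K := compact_measurable_mx cK.

Let M0 : (0 <= M)%R. Proof. exact: le_trans (f0 0%R) (fM 0%R). Qed.

Let rKL x : (restricted f L x <= restricted f K x)%R.
Proof.
rewrite /restricted ler_wpM2r// !indicE.
have [/set_mem/LK Kx|//] := boolP (x \in L).
by rewrite mem_set.
Qed.

Let mr C : measurable C -> measurable_fun setT (restricted f C).
Proof. exact: measurable_restricted. Qed.

Let r0 C x : (0 <= restricted f C x)%R. Proof. exact: restricted_ge0. Qed.

Let total (C : set 'rV[R]_(m + k)) := \int[leb 1 (m + k)]_x (restricted f C x)%:E.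

Lemma integral_restricted_fin (n : nat) (h : 'rV[R]_n -> 'rV[R]_(m + k))
    (C : set 'rV[R]_(m + k)) :
  measurable_fun setT h -> C `<=` K -> measurable C ->
  leb 1 n (h @^-1` K) < +oo ->
  \int[leb 1 n]_x (restricted f C (h x))%:E < +oo.
Proof.
move=> mh CK mC fin.
have mhK : measurable (h @^-1` K) by rewrite -[X in measurable X]setTI; exact: mh.
apply: (@le_lt_trans _ _ (\int[leb 1 n]_x (M * \1_(h @^-1` K) x)%:E)).
  apply: ge0_le_integral => //.
  - by move=> x _; rewrite lee_fin.
  - by apply/measurable_EFinP; apply: (measurableT_comp (mr mC)).
  - by apply/measurable_EFinP; apply: measurable_funM.
  move=> x _; rewrite lee_fin /restricted !indicE mulrC.
  apply: ler_pM => //; have [/set_mem/CK Kx|//] := boolP (h x \in C).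
  by rewrite mem_set.
under eq_integral do rewrite EFinM.
rewrite ge0_integralZl//; last by apply/measurable_EFinP.
by rewrite integral_indic// setIT lte_mul_pinfty.
Qed.

Let total_fin C : C `<=` K -> measurable C -> total C < +oo.
Proof.
move=> CK mC; apply: (@integral_restricted_fin _ id) => //.
have [r Kr] := compact_entry_bound cK.
exact: (lebesgue_mx_bounded mK Kr).
Qed.

Let fiber_fin A C : C `<=` K -> measurable C -> fiber_integral f A C < +oo.
Proof.
move=> CK mC; apply: (@integral_restricted_fin m (fun y => y *m row_mx 1%:M A)%R) => //.
  exact: measurable_fun_mulmx.
have [r Kr] := compact_entry_bound cK.
exact: (lebesgue_mx_bounded (measurable_graph_fiber A mK) (graph_fiber_bound Kr)).
Qed.

Let P C (n : nat) (h : 'rV[R]_n -> 'rV[R]_(m + k)) (X : 'M[R]_(m, n)) : R :=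
  (\prod_(i < m) restricted f C (h (row i X)))%R.

Let mP C n (h : 'rV[R]_n -> 'rV[R]_(m + k)) : measurable C ->
  measurable_fun setT h -> measurable_fun setT (P C h).
Proof.
move=> mC mh; apply: measurable_prod => i _.
apply: (measurableT_comp (mr mC)); apply: (measurableT_comp mh).
exact: measurable_fun_row.
Qed.

Let PLK n (h : 'rV[R]_n -> 'rV[R]_(m + k)) X : (P L h X <= P K h X)%R.
Proof. by apply: ler_prod => i _; rewrite r0 rKL. Qed.

Let P0 C n (h : 'rV[R]_n -> 'rV[R]_(m + k)) X : (0 <= P C h X)%R.
Proof. exact: prodr_ge0. Qed.

(** The [m]-th power of an integral is an integral over [m]-tuples; the difference
    of powers collects the tuples from [K] that do not all lie in [L]. *)
Lemma expe_sub_integral (n : nat) (h : 'rV[R]_n -> 'rV[R]_(m + k)) :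
  measurable_fun setT h ->
  (\int[leb 1 n]_x (restricted f L (h x))%:E) < +oo ->
  (\int[leb 1 n]_x (restricted f K (h x))%:E) ^+ m -
  (\int[leb 1 n]_x (restricted f L (h x))%:E) ^+ m =
  \int[leb m n]_X (P K h X - P L h X)%:E.
Proof.
move=> mh Lfin.
have powE C : measurable C ->
    (\int[leb 1 n]_x (restricted f C (h x))%:E) ^+ m =
    \int[leb m n]_X (P C h X)%:E.
  move=> mC; rewrite (@integral_prod_rows R m n (fun x => restricted f C (h x)))//.
  by apply: (measurableT_comp (mr mC)).
have finL : \int[leb m n]_X (P L h X)%:E \is a fin_num.
  rewrite -powE// fin_numX// ge0_fin_numE//.
  by apply: integral_ge0 => x _; rewrite lee_fin.
rewrite !powE//.
suff -> : \int[leb m n]_X (P K h X)%:E =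
    \int[leb m n]_X (P K h X - P L h X)%:E + \int[leb m n]_X (P L h X)%:E.
  by rewrite addeK.
rewrite -ge0_integralD//.
- by apply: eq_integral => X _; rewrite -EFinD subrK.
- by move=> X _; rewrite lee_fin subr_ge0.
- by apply/measurable_EFinP; apply: measurable_funB; exact: mP.
- by move=> X _; rewrite lee_fin.
- by apply/measurable_EFinP; exact: mP.
Qed.

Lemma section_sub_integral (A : 'M[R]_(m, k)) :
  \int[leb m m]_Y (P K (fun y => y *m row_mx 1%:M A)%R Y -
                   P L (fun y => y *m row_mx 1%:M A)%R Y)%:E =
  (graph_factor A ^+ m)%:E *
  (section_measure f (graph_space A) K ^+ m -
   section_measure f (graph_space A) L ^+ m).
Proof.
have mh : measurable_fun setT (fun y : 'rV[R]_m => y *m row_mx 1%:M A)%R.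
  exact: measurable_fun_mulmx.
have Lfin : fiber_integral f A L < +oo by apply: fiber_fin.
have Kfin : fiber_integral f A K < +oo by apply: fiber_fin.
rewrite -(expe_sub_integral mh Lfin).
rewrite -/(fiber_integral f A K) -/(fiber_integral f A L).
move: Kfin Lfin; rewrite !fiber_integralE//.
have t0 := graph_factor_gt0 A.
have s0 C : 0 <= section_measure f (graph_space A) C.
  by apply: integral_ge0 => x _; rewrite lee_fin.
have fin s : 0 <= s -> (graph_factor A)%:E * s < +oo -> s \is a fin_num.
  case: s => [r|_|] //; by rewrite gt0_muley ?lte_fin// ltxx.
move=> /(fin _ (s0 K)) finK /(fin _ (s0 L)) finL.
rewrite -(fineK finK) -(fineK finL) -!EFinM -!EFin_expe -!EFinB -EFinM.
by rewrite !exprMn mulrBr.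
Qed.

Let support_rows A Y :
  (P K (fun y => y *m row_mx 1%:M A) Y != 0)%R -> rows_in (graph_fiber A K) Y.
Proof.
move=> /prodf_neq0 PK i; have := PK i isT.
rewrite /restricted mulf_eq0 negb_or indicE => /andP[+ _].
by rewrite pnatr_eq0 eqb0 negbK => /set_mem.
Qed.

(** In the fibre over [A] the factor [|det Y|^k] is replaced by the bound of
    [det_fiber_weight], which does not depend on [Y]; what remains integrates to
    the difference of the sections by the graph of [A], at most [S]. *)
Lemma slicing_inequality (V : R) (S : \bar R) :
  (0 < V)%R -> leb 1 (m + k) K = V%:E ->
  (forall A : 'M[R]_(m, k), section_measure f (graph_space A) K ^+ m -
      section_measure f (graph_space A) L ^+ m <= S) ->
  total K ^+ m - total L ^+ m <=
  ((4 / gauss_const R * Num.sqrt m%:R) ^+ (k * m) *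
    V `^ ((k * m)%:R / (m + k)%:R))%:E * S.
Proof.
move=> V0 KV SA.
set B := (_ * V `^ _)%R.
have B0 : (0 <= B)%R.
  rewrite mulr_ge0 ?powR_ge0// exprn_ge0// mulr_ge0 ?sqrtr_ge0//.
  by rewrite divr_ge0// ltW// gauss_const_gt0.
have idm : measurable_fun setT (id : 'rV[R]_(m + k) -> 'rV[R]_(m + k)).
  exact: measurable_id.
have tL : total L < +oo by exact: total_fin.
rewrite /total (expe_sub_integral idm tL).
pose h (A : 'M[R]_(m, k)) (y : 'rV[R]_m) : 'rV[R]_(m + k) := (y *m row_mx 1%:M A)%R.
have mh A : measurable_fun setT (h A) by exact: measurable_fun_mulmx.
have mD n (g : 'rV[R]_n -> 'rV[R]_(m + k)) : measurable_fun setT g ->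
    measurable_fun setT (fun X => (P K g X - P L g X)%:E).
  by move=> mg; apply/measurable_EFinP; apply: measurable_funB; exact: mP.
have D0 n (g : 'rV[R]_n -> 'rV[R]_(m + k)) X : 0 <= (P K g X - P L g X)%:E.
  by rewrite lee_fin subr_ge0.
rewrite blaschke_petkantschin//; last exact: mD.
have PE C A Y : P C id (row_mx Y (Y *m A)%R) = P C (h A) Y.
  by apply: eq_bigr => i _; rewrite /h -row_mul mul_mx_row mulmx1.
have w0 A := fiber_weight_ge0 K A V0.
have S0 : 0 <= S.
  apply: le_trans (SA 0%R).
  rewrite -(@lee_pmul2l _ (graph_factor (0%R : 'M[R]_(m, k)) ^+ m)%:E)//.
    by rewrite mule0 -section_sub_integral; apply: integral_ge0.
  by rewrite lte_fin exprn_gt0// graph_factor_gt0.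
have fiberle A :
    \int[leb m m]_Y ((`|\det Y| ^+ k)%:E *
      (P K id (row_mx Y (Y *m A)%R) - P L id (row_mx Y (Y *m A)%R))%:E) <=
    B%:E * fiber_weight K V A * S.
  have t0 := graph_factor_gt0 A.
  have tm0 : (0 < graph_factor A ^+ m)%R by rewrite exprn_gt0.
  pose c := (graph_factor A ^- m)%:E * (B%:E * fiber_weight K V A).
  have c0 : 0 <= c by rewrite !mule_ge0 ?lee_fin// invr_ge0 ltW.
  apply: (@le_trans _ _ (\int[leb m m]_Y (c * (P K (h A) Y - P L (h A) Y)%:E))).
    apply: ge0_le_integral => //.
    - by move=> Y _; rewrite mule_ge0// lee_fin exprn_ge0.
    - under eq_fun do rewrite !PE.
      apply: emeasurable_funM; last exact: mD.
      by apply/measurable_EFinP; exact: measurable_fun_normdetX.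
    - by apply: emeasurable_funM => //; exact: mD.
    move=> Y _; rewrite !PE.
    have [PK0|PKn0] := eqVneq (P K (h A) Y) 0%R.
      have PL0 : P L (h A) Y = 0%R.
        by apply/eqP; rewrite eq_le P0 andbT -PK0 PLK.
      by rewrite PK0 PL0 subrr !mule0.
    apply: lee_wpmul2r => //.
    have := det_fiber_weight mK m0 k0 V0 convK K0 (support_rows PKn0).
    rewrite -/B => H; rewrite /c -(@lee_pmul2l _ (graph_factor A ^+ m)%:E)// ?lte_fin//.
    by rewrite muleA -!EFinM divff ?gt_eqF// mul1e mulrC.
  rewrite ge0_integralZl//; last exact: mD.
  rewrite section_sub_integral /c muleACA -EFinM mulVf ?gt_eqF// mul1e.
  by apply: lee_wpmul2l => //; rewrite mule_ge0.
have mBw : measurable_fun setT (fun A => B%:E * fiber_weight K V A).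
  by apply: measurable_funeM; exact: measurable_fiber_weight.
apply: (@le_trans _ _ (\int[leb m k]_A (B%:E * fiber_weight K V A * S))).
  apply: ge0_le_integral => //.
  - by move=> A _; apply: integral_ge0 => Y _; rewrite mule_ge0.
  - apply: (@measurable_fun_fubini_tonelli_F _ _ _ _ R (leb m m)
      (fun p : 'M[R]_(m, k) * 'M[R]_m => (`|\det p.2| ^+ k)%:E *
        (P K id (row_mx p.2 (p.2 *m p.1)%R) -
         P L id (row_mx p.2 (p.2 *m p.1)%R))%:E)) => //.
      apply: emeasurable_funM.
        by apply/measurable_EFinP; exact: measurable_fun_normdetX.
      apply: (measurableT_comp (mD _ _ idm)).
      by apply: measurable_fun_row_mx => //; exact: measurable_fun_mulmx.
    by move=> p; rewrite mule_ge0.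
  - by apply: emeasurable_funM.
rewrite ge0_integralZr//; last by move=> A _; rewrite mule_ge0.
rewrite ge0_integralZl//; last exact: measurable_fiber_weight.
by rewrite (integral_fiber_weight mK _ V0 KV) ?mule1// addn_gt0 m0.
Qed.

End main_inequality.

(** * The slicing inequality *)

Lemma slicing_inequality_density (R : realType) (m k : nat) (K L : set 'rV[R]_(m + k))
    (mu : {measure set 'rV[R]_(m + k) -> \bar R}) (f : 'rV[R]_(m + k) -> R) :
  (0 < m)%N -> (0 < k)%N ->
  convex_body K -> K 0 -> measurable L -> L `<=` K ->
  measurable_fun [set: 'rV[R]_(m + k)] f ->
  (forall x, 0 <= f x) -> (exists M : R, forall x, f x <= M) ->
  has_density mu f ->
  (mu K ^+ m - mu L ^+ m <=
     ((4 / gauss_const R * Num.sqrt m%:R) ^+ (k * m))%:E *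
     lebesgue_rV R (m + k) K `^ ((k * m)%:R / (m + k)%:R) *
     ereal_sup [set (section_measure f F K ^+ m - section_measure f F L ^+ m)%E
               | F in @Grassmannian R (m + k) m])%E.
Proof.
move=> m0 k0 [cK convK _] K0 mL LK mf f0 [M fM] muf.
have mK := compact_measurable_mx cK.
have muE C : measurable C ->
    mu C = (\int[@lebesgue_mx R 1 (m + k)]_x (restricted f C x)%:E)%E.
  move=> mC; rewrite muf// integral_restricted integral_lebesgue_rV//.
    by apply/measurable_EFinP; exact: measurable_restricted.
  by move=> x; rewrite lee_fin restricted_ge0.
have VE : lebesgue_rV R (m + k) K = @lebesgue_mx R 1 (m + k) K.
  have := @integral_lebesgue_rV R (m + k) (fun x => (\1_K x)%:E).
  rewrite !integral_indic// !setIT => ->//.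
    by apply/measurable_EFinP.
have Vfin : (@lebesgue_mx R 1 (m + k) K < +oo)%E.
  have [r Kr] := compact_entry_bound cK.
  exact: (lebesgue_mx_bounded mK Kr).
set S := ereal_sup _.
have SA (A : 'M[R]_(m, k)) : (section_measure f (graph_space A) K ^+ m -
    section_measure f (graph_space A) L ^+ m <= S)%E.
  apply: ereal_sup_ubound; exists (graph_space A) => //.
  exact: dim_graph_space.
have fV : (@lebesgue_mx R 1 (m + k) K \is a fin_num)%E.
  by rewrite ge0_fin_numE.
have KV := VE; rewrite {}VE -(fineK fV); set V := fine _.
have VE : (@lebesgue_mx R 1 (m + k) K = V%:E)%E by rewrite fineK.
have V0 : 0 <= V by rewrite fine_ge0.
have [V00|Vn0] := eqVneq V 0; last first.
  rewrite poweR_EFin -EFinM !muE//.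
  apply: (slicing_inequality m0 k0 cK convK K0 mL LK mf f0 fM _ VE SA).
  by rewrite lt_def Vn0.
have null C : measurable C -> C `<=` K -> mu C = 0%E.
  move=> mC CK; rewrite muf//; apply: null_set_integral => //.
    by apply: measurable_funTS; apply/measurable_EFinP.
  apply: (subset_measure0 mC mK CK); apply: etrans KV _.
  by rewrite VE V00.
rewrite !null// V00 poweR0r; last first.
  by rewrite mulf_neq0 ?invr_neq0// pnatr_eq0 -lt0n ?muln_gt0 ?addn_gt0 ?m0 ?k0.
rewrite mule0 mul0e.
by case: (m) m0 => // m' _; rewrite expeS mul0e sube0.
Qed.

Theorem theorem1p5 (R : realType) :
  exists c0 : R, 0 < c0 /\
  forall (n k : nat), (1 <= k)%N -> (k < n)%N ->
  forall (K L : set 'rV[R]_n),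
    convex_body K -> K 0 -> measurable L -> L `<=` K ->
  forall (mu : {measure set 'rV[R]_n -> \bar R}) (f : 'rV[R]_n -> R),
    measurable_fun [set: 'rV[R]_n] f ->
    (forall x, 0 <= f x) ->
    (exists M : R, forall x, f x <= M) ->
    has_density mu f ->
  (mu K ^+ (n - k) - mu L ^+ (n - k) <=
     ((c0 * Num.sqrt (n - k)%:R) ^+ (k * (n - k)))%:E *
     lebesgue_rV R n K `^ ((k * (n - k))%:R / n%:R) *
     ereal_sup [set (section_measure f F K ^+ (n - k) -
                     section_measure f F L ^+ (n - k))%E
               | F in @Grassmannian R n (n - k)])%E.
Proof.
exists (4 / gauss_const R); split; first by rewrite divr_gt0 ?gauss_const_gt0.
move=> n k k0 kn.
have [m -> m0] : exists2 m, n = (m + k)%N & (0 < m)%N.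
  by exists (n - k)%N; rewrite ?subn_gt0// subnK// ltnW.
move=> K L bK K0 mL LK mu f mf f0 fM muf.
rewrite addnK. refine (slicing_inequality_density m0 k0 bK K0 mL LK mf f0 fM muf).
Qed.
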